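(* If $K \subset \mathbb{R}^3$ is a nontrivial torus knot, then the knot group $\pi_1(\mathbb{R}^3 \setminus K)$ contains a generalized torsion element.
   Context: A (classical) knot is a subset $K$ of $\mathbb{R}^3$ homeomorphic to the circle $S^1$, assumed smooth or piecewise linear; its knot group is $\pi_1(\mathbb{R}^3 \setminus K)$. A torus knot is a knot that can be inscribed on the surface of an unknotted solid torus in $\mathbb{R}^3$. For relatively prime integers $p,q$, the group of the $p,q$-torus knot is $\langle x, y : x^p = y^q \rangle$, and the knot is nontrivial exactly when $|p|>1$ and $|q|>1$. A generalized torsion element of a group $G$ with identity $1$ is an element $g \neq 1$ for which there exist $k \ge 1$ and $y_1, \dots, y_k \in G$ with $g^{y_1} g^{y_2} \cdots g^{y_k} = 1$, where $g^y := y^{-1} g y$. *)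

(* Defs.v *)
From HB Require Import structures.
From mathcomp Require Import all_boot all_order all_algebra generic_quotient.
From mathcomp Require Import all_classical all_reals all_analysis.
From mathcomp Require Import lra.
Set Implicit Arguments.
Unset Strict Implicit.
Unset Printing Implicit Defensive.
Import Order.TTheory GRing.Theory Num.Theory numFieldNormedType.Exports.

Local Open Scope classical_set_scope.
Local Open Scope ring_scope.

Section GeneralizedTorsion.
Local Open Scope group_scope.

(* [conjg g y] is y^-1 * (g * y). *)
Definition generalized_torsion (G : groupType) (g : G) : Prop :=
  g <> 1 /\ exists (k : nat) (y : 'I_k -> G),
    (0 < k)%N /\ \big[*%g/1]_(i < k) conjg g (y i) = 1.

End GeneralizedTorsion.

Section Gluing.
Variable R : realType.
Implicit Types T U V W : topologicalType.

Definition clamp (t : R) : R := Num.max 0 (Num.min 1 t).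

Lemma clamp_itv t : `[0, 1]%classic (clamp t).
Proof.
rewrite /= in_itv /= /clamp le_max lexx /= ge_max ler01 /=.
by rewrite ge_min lexx.
Qed.

Lemma clamp_id t : `[0, 1]%classic t -> clamp t = t.
Proof.
rewrite /= in_itv /= => /andP[t0 t1].
by rewrite /clamp (min_idPr t1) (max_idPr t0).
Qed.

Lemma clamp0 : clamp 0 = 0.
Proof. by apply: clamp_id; rewrite /= in_itv /= lexx ler01. Qed.

Lemma clamp1 : clamp 1 = 1.
Proof. by apply: clamp_id; rewrite /= in_itv /= lexx ler01. Qed.

Lemma continuous_clamp : continuous clamp.
Proof.
move=> t; apply: continuous_max; first exact: cst_continuous.
by apply: continuous_min; [exact: cst_continuous|].
Qed.

Lemma continuous_pairfun U V W (f : U -> V) (g : U -> W) :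
  continuous f -> continuous g -> continuous (fun x => (f x, g x)).
Proof.
by move=> cf cg x; apply: cvg_pair => /=; [exact: cf|exact: cg].
Qed.

Lemma continuous_compfun U V W (f : U -> V) (g : V -> W) :
  continuous f -> continuous g -> continuous (fun x => g (f x)).
Proof. by move=> cf cg x; apply: continuous_comp; [exact: cf|exact: cg]. Qed.

Lemma continuous_fst U V : continuous (@fst U V).
Proof. by move=> x; exact: cvg_fst. Qed.

Lemma continuous_snd U V : continuous (@snd U V).
Proof. by move=> x; exact: cvg_snd. Qed.

Lemma continuous_scale U (u : U -> R) (a : R) :
  continuous u -> continuous (fun x => a * u x).
Proof. by move=> cu; apply: (continuous_compfun cu); exact: mulrl_continuous. Qed.

Lemma continuous_shift U (u : U -> R) (a : R) :
  continuous u -> continuous (fun x => u x + a).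
Proof.
move=> cu x; apply: (@continuousD _ _ _ u (cst a)); first exact: cu.
exact: cst_continuous.
Qed.

Lemma continuous_within_comp U V W (A : set V) (f : V -> W) (g : U -> V) :
  {within A, continuous f} -> continuous g -> (forall x, A (g x)) ->
  continuous (f \o g).
Proof.
move=> /subspace_sigL_continuousP cf cg Ag.
pose g' (x : U) : A := exist _ (g x) (mem_set (Ag x)).
have cg' : continuous g'.
  by apply: continuous_comp_initial => x; exact: cg.
have -> : f \o g = sigL A f \o g' by [].
by move=> x; apply: continuous_comp; [exact: cg'|exact: cf].
Qed.

Lemma continuous_paste U W (u : U -> R) (F G : U -> W) :
  continuous u -> continuous F -> continuous G ->
  (forall x, u x = 0 -> F x = G x) ->
  continuous (fun x => if u x <= 0 then F x else G x).
Proof.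
move=> cu cF cG FG.
pose A := u @^-1` [set y | y <= 0]; pose B := u @^-1` [set y | 0 <= y].
have cA : closed A by apply: closed_comp => [x _|]; [exact: cu|exact: closed_le].
have cB : closed B by apply: closed_comp => [x _|]; [exact: cu|exact: closed_ge].
apply/continuous_subspace_setT.
have -> : [set: U] = A `|` B.
  apply/seteqP; split => x // _; rewrite /A /B /=.
  by case: (leP (u x) 0) => [|/ltW]; [left|right].
apply: withinU_continuous => //.
- apply: (@subspace_eq_continuous _ _ _ F); last exact: continuous_subspaceT.
  by move=> x; rewrite inE /from_subspace => Ax; rewrite ifT.
- apply: (@subspace_eq_continuous _ _ _ G); last exact: continuous_subspaceT.
  move=> x; rewrite inE /from_subspace => u0; case: ifPn => // u0'.
  by apply/esym/FG/le_anti; rewrite u0' u0.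
Qed.

End Gluing.

Section FundamentalGroup.
Variables (R : realType) (T : topologicalType) (b : T).

(* Only the values on [0, 1] matter; homotopy ignores the others. *)
Record loop := Loop {
  loop_fun :> R -> T;
  loop_continuous : {within `[0, 1]%classic, continuous loop_fun};
  loop0 : loop_fun 0 = b;
  loop1 : loop_fun 1 = b }.

Arguments loop_continuous : clear implicits.

HB.instance Definition _ := gen_eqMixin loop.
HB.instance Definition _ := gen_choiceMixin loop.

Definition loop_homotopic (f g : loop) : Prop :=
  exists H : R * R -> T,
    [/\ {within `[0, 1]%classic `*` `[0, 1]%classic, continuous H},
        forall t, `[0, 1]%classic t -> H (0, t) = f t /\ H (1, t) = g t &
        forall s, `[0, 1]%classic s -> H (s, 0) = b /\ H (s, 1) = b].

Let I01_0 : `[0, 1]%classic (0 : R).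
Proof. by rewrite /= in_itv /= lexx ler01. Qed.

Let I01_1 : `[0, 1]%classic (1 : R).
Proof. by rewrite /= in_itv /= lexx ler01. Qed.

Lemma loop_homotopic_total (H : R * R -> T) (f g : loop) :
  continuous H ->
  (forall t, `[0, 1]%classic t -> H (0, t) = f t) ->
  (forall t, `[0, 1]%classic t -> H (1, t) = g t) ->
  (forall s, `[0, 1]%classic s -> H (s, 0) = b) ->
  (forall s, `[0, 1]%classic s -> H (s, 1) = b) ->
  loop_homotopic f g.
Proof.
move=> cH Hf Hg H0 H1; exists H; split.
- exact: continuous_subspaceT.
- by move=> t t01; split; [exact: Hf|exact: Hg].
- by move=> s s01; split; [exact: H0|exact: H1].
Qed.

Lemma loop_homotopic_extend (f g : loop) : loop_homotopic f g ->
  exists H : R * R -> T,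
    [/\ continuous H, forall t, H (0, t) = f (clamp t),
        forall t, H (1, t) = g (clamp t),
        forall s t, t <= 0 -> H (s, t) = b &
        forall s t, 1 <= t -> H (s, t) = b].
Proof.
move=> [H [cH Hfg Hb]].
exists (H \o (fun x => (clamp x.1, clamp x.2))); split => /=.
- apply: (continuous_within_comp cH).
    apply: continuous_pairfun; apply: continuous_compfun.
    - exact: continuous_fst.
    - exact: continuous_clamp.
    - exact: continuous_snd.
    - exact: continuous_clamp.
  by move=> x; split; exact: clamp_itv.
- by move=> t; rewrite clamp0; case: (Hfg _ (clamp_itv t)).
- by move=> t; rewrite clamp1; case: (Hfg _ (clamp_itv t)).
- move=> s t t0; rewrite {2}/clamp (min_idPr (le_trans t0 ler01)).
  by rewrite (max_idPl t0); case: (Hb _ (clamp_itv s)).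
- move=> s t t1; rewrite {2}/clamp (min_idPl t1).
  by rewrite (max_idPr ler01); case: (Hb _ (clamp_itv s)).
Qed.

Lemma loop_clamp_continuous (f : loop) : continuous (f \o @clamp R).
Proof.
apply: (continuous_within_comp (loop_continuous f)).
  exact: continuous_clamp.
exact: clamp_itv.
Qed.

Arguments loop_clamp_continuous : clear implicits.

Lemma loop_homotopic_reparam (f g h : loop) (u v : R -> R) :
  continuous u -> continuous v ->
  (forall t, `[0, 1]%classic t -> g t = f (clamp (u t))) ->
  (forall t, `[0, 1]%classic t -> h t = f (clamp (v t))) ->
  u 0 = v 0 -> u 1 = v 1 -> loop_homotopic g h.
Proof.
move=> cu cv gu hv u0 u1.
pose w (x : R * R) : R := u x.2 + x.1 * (v x.2 - u x.2).
apply: (@loop_homotopic_total ((f \o @clamp R) \o w)).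
- move=> x; apply: continuous_comp; last exact: loop_clamp_continuous.
  have c2 (k : R -> R) : continuous k -> {for x, continuous (k \o snd)}.
    by move=> ck; apply: continuous_comp; [exact: cvg_snd|exact: ck].
  apply: continuousD; first exact: c2.
  apply: continuousM; first exact: cvg_fst.
  by apply: continuousB; exact: c2.
- by move=> t t01; rewrite /w /= mul0r addr0 gu.
- by move=> t t01; rewrite /w /= mul1r addrC subrK hv.
- by move=> s s01; rewrite /w /= -u0 subrr mulr0 addr0 -gu// loop0.
- by move=> s s01; rewrite /w /= -u1 subrr mulr0 addr0 -gu// loop1.
Qed.

Definition loop_homotopicb (f g : loop) : bool := `[< loop_homotopic f g >].

Lemma loop_homotopicb_refl : reflexive loop_homotopicb.
Proof.
move=> f; apply/asboolP.
apply: (@loop_homotopic_reparam f f f id id) => //.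
all: by move=> t //= t01; rewrite clamp_id.
Qed.

Lemma loop_homotopic_sym f g : loop_homotopic f g -> loop_homotopic g f.
Proof.
move=> /loop_homotopic_extend[H [cH Hf Hg H0 H1]].
apply: (@loop_homotopic_total (H \o (fun x => (1 - x.1, x.2)))) => /=.
- apply: continuous_compfun; last exact: cH.
  apply: continuous_pairfun; last exact: continuous_snd.
  by move=> x; apply: continuousB; [exact: cst_continuous|exact: cvg_fst].
- by move=> t t01; rewrite subr0 Hg clamp_id.
- by move=> t t01; rewrite subrr Hf clamp_id.
- by move=> s _; rewrite H0.
- by move=> s _; rewrite H1.
Qed.

Lemma loop_homotopicb_sym : symmetric loop_homotopicb.
Proof.
by move=> f g; apply/asboolP/asboolP; exact: loop_homotopic_sym.
Qed.

Lemma loop_homotopicb_trans : transitive loop_homotopicb.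
Proof.
move=> g f h /asboolP/loop_homotopic_extend[H [cH Hf Hg H0 H1]].
move=> /asboolP/loop_homotopic_extend[K [cK Kg Kh K0 K1]].
apply/asboolP.
apply: (@loop_homotopic_total (fun x => if 2 * x.1 - 1 <= 0
   then H (2 * x.1, x.2) else K (2 * x.1 - 1, x.2))) => /=.
- have c1 : continuous (fun x : R * R => 2 * x.1).
    by apply: continuous_scale; exact: continuous_fst.
  have c2 : continuous (fun x : R * R => 2 * x.1 - 1).
    exact: continuous_shift.
  apply: (@continuous_paste R _ _ (fun x : R * R => 2 * x.1 - 1)
    (fun x => H (2 * x.1, x.2)) (fun x => K (2 * x.1 - 1, x.2))) => //.
  + apply: (continuous_compfun (g := H)) => //.
    by apply: continuous_pairfun => //; exact: continuous_snd.
  + apply: (continuous_compfun (g := K)) => //.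
    by apply: continuous_pairfun => //; exact: continuous_snd.
  + by move=> x x0; rewrite x0 Kg; move/eqP: x0; rewrite subr_eq0 => /eqP ->.
- by move=> t t01; rewrite mulr0 sub0r lerN10 Hf clamp_id.
- move=> t t01; rewrite mulr1 (_ : 2 - 1 = 1 :> R) ?ler10 ?Kh ?clamp_id//.
  by rewrite -[2]/(1 + 1) addrK.
- by move=> s _; case: ifP; rewrite ?H0 ?K0.
- by move=> s _; case: ifP; rewrite ?H1 ?K1.
Qed.

Definition loop_equiv : equiv_rel loop :=
  EquivRel loop_homotopicb
    loop_homotopicb_refl loop_homotopicb_sym loop_homotopicb_trans.

Definition pi1 : Type := {eq_quot loop_equiv}%qT.

HB.instance Definition _ := Choice.on pi1.
HB.instance Definition _ := EqQuotient.on pi1.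

Definition loop_class (f : loop) : pi1 := (\pi_pi1 f)%qT.

Lemma loop_classP (f g : loop) :
  loop_class f = loop_class g <-> loop_homotopic f g.
Proof.
split=> [|fg]; first by move/eqquotP/asboolP.
by apply/eqquotP/asboolP.
Qed.

Definition loop_rep (x : pi1) : loop := repr x.

Lemma loop_repK (x : pi1) : loop_class (loop_rep x) = x.
Proof. exact: reprK. Qed.

Lemma loop_cst_continuous : {within `[0, 1]%classic, continuous (fun _ : R => b)}.
Proof. by apply: continuous_subspaceT => x; exact: cst_continuous. Qed.

Definition loop_cst : loop := Loop loop_cst_continuous erefl erefl.

Section Reverse.
Variable f : loop.

Definition loop_rev_fun (t : R) : T := f (1 - t).

Lemma loop_rev_continuous : {within `[0, 1]%classic, continuous loop_rev_fun}.
Proof.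
apply: (@subspace_eq_continuous _ _ _ ((f \o @clamp R) \o (fun t => 1 - t))).
  move=> t; rewrite inE /from_subspace => t01; rewrite /loop_rev_fun /= clamp_id//.
  move: t01; rewrite /= !in_itv /= => /andP[t0 t1].
  by rewrite subr_ge0 t1 gerBl t0.
apply: continuous_subspaceT => t; apply: continuous_comp.
  by apply: continuousB; [exact: cst_continuous|].
exact: loop_clamp_continuous.
Qed.

Lemma loop_rev0 : loop_rev_fun 0 = b.
Proof. by rewrite /loop_rev_fun subr0 loop1. Qed.

Lemma loop_rev1 : loop_rev_fun 1 = b.
Proof. by rewrite /loop_rev_fun subrr loop0. Qed.

Definition loop_rev : loop := Loop loop_rev_continuous loop_rev0 loop_rev1.

End Reverse.

Section Concatenation.
Variables f g : loop.

Definition loop_cat_fun (t : R) : T :=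
  if 2 * t - 1 <= 0 then f (2 * t) else g (2 * t - 1).

Lemma loop_cat_continuous : {within `[0, 1]%classic, continuous loop_cat_fun}.
Proof.
have c1 : continuous (fun t : R => 2 * t).
  by apply: continuous_scale => t.
have c2 : continuous (fun t : R => 2 * t - 1).
  exact: continuous_shift.
apply: (@subspace_eq_continuous _ _ _ (fun t : R => if 2 * t - 1 <= 0
    then f (clamp (2 * t)) else g (clamp (2 * t - 1)))).
  move=> t; rewrite inE /from_subspace /= in_itv /= => /andP[t0 t1].
  rewrite /loop_cat_fun; case: ifPn => h; rewrite clamp_id//= in_itv /=.
    by rewrite mulr_ge0//= -subr_le0.
  rewrite ltW/= ?ltNge//; rewrite lerBlDr -[1 + 1]/(2 : R).
  by rewrite -[leRHS]mulr1 ler_wpM2l.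
apply: continuous_subspaceT.
apply: (@continuous_paste R _ _ (fun t : R => 2 * t - 1)
  (fun t => f (clamp (2 * t))) (fun t => g (clamp (2 * t - 1)))) => //.
- exact: (continuous_compfun c1 (loop_clamp_continuous f)).
- exact: (continuous_compfun c2 (loop_clamp_continuous g)).
- move=> t t0; rewrite t0 clamp0 loop0; move/eqP: t0; rewrite subr_eq0.
  by move=> /eqP ->; rewrite clamp1 loop1.
Qed.

Lemma loop_cat0 : loop_cat_fun 0 = b.
Proof. by rewrite /loop_cat_fun mulr0 sub0r lerN10 loop0. Qed.

Lemma loop_cat1 : loop_cat_fun 1 = b.
Proof.
rewrite /loop_cat_fun mulr1 (_ : 2 - 1 = 1 :> R) ?ler10 ?loop1//.
by rewrite -[2]/(1 + 1) addrK.
Qed.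

Definition loop_cat : loop := Loop loop_cat_continuous loop_cat0 loop_cat1.

End Concatenation.

Definition pi1_one : pi1 := loop_class loop_cst.
Definition pi1_inv (x : pi1) : pi1 := loop_class (loop_rev (loop_rep x)).
Definition pi1_mul (x y : pi1) : pi1 :=
  loop_class (loop_cat (loop_rep x) (loop_rep y)).

Lemma loop_homotopic_rev (f g : loop) :
  loop_homotopic f g -> loop_homotopic (loop_rev f) (loop_rev g).
Proof.
move=> /loop_homotopic_extend[H [cH Hf Hg H0 H1]].
have I1 t : `[0, 1]%classic t -> `[0, 1]%classic (1 - t : R).
  rewrite /= !in_itv /= => /andP[t0 t1].
  by rewrite subr_ge0 t1 gerBl t0.
apply: (@loop_homotopic_total (H \o (fun x => (x.1, 1 - x.2)))) => /=.
- apply: continuous_compfun; last exact: cH.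
  apply: continuous_pairfun; first exact: continuous_fst.
  by move=> x; apply: continuousB; [exact: cst_continuous|exact: cvg_snd].
- by move=> t t01; rewrite Hf clamp_id//; exact: I1.
- by move=> t t01; rewrite Hg clamp_id//; exact: I1.
- by move=> s _; rewrite H1// subr0.
- by move=> s _; rewrite H0// subrr.
Qed.

Lemma loop_cat_clamp (f g : loop) t : `[0, 1]%classic t ->
  loop_cat f g t = if 2 * t - 1 <= 0
    then f (clamp (2 * t)) else g (clamp (2 * t - 1)).
Proof.
rewrite /= in_itv /= => /andP[t0 t1]; rewrite /loop_cat_fun.
case: ifPn => h; rewrite clamp_id//= in_itv /=.
  by rewrite mulr_ge0//= -subr_le0.
rewrite ltW/= ?ltNge//; rewrite lerBlDr -[1 + 1]/(2 : R).
by rewrite -[leRHS]mulr1 ler_wpM2l.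
Qed.

Lemma loop_homotopic_cat (f f' g g' : loop) :
  loop_homotopic f f' -> loop_homotopic g g' ->
  loop_homotopic (loop_cat f g) (loop_cat f' g').
Proof.
move=> /loop_homotopic_extend[H [cH Hf Hg H0 H1]].
move=> /loop_homotopic_extend[K [cK Kf Kg K0 K1]].
apply: (@loop_homotopic_total (fun x => if 2 * x.2 - 1 <= 0
   then H (x.1, 2 * x.2) else K (x.1, 2 * x.2 - 1))).
- have c1 : continuous (fun x : R * R => 2 * x.2).
    by apply: continuous_scale; exact: continuous_snd.
  have c2 : continuous (fun x : R * R => 2 * x.2 - 1).
    exact: continuous_shift.
  apply: (@continuous_paste R _ _ (fun x : R * R => 2 * x.2 - 1)
    (fun x => H (x.1, 2 * x.2)) (fun x => K (x.1, 2 * x.2 - 1))) => //.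
  + apply: (continuous_compfun (g := H)) => //.
    by apply: continuous_pairfun => //; exact: continuous_fst.
  + apply: (continuous_compfun (g := K)) => //.
    by apply: continuous_pairfun => //; exact: continuous_fst.
  + move=> x x0; rewrite K0 ?x0// H1//; move/eqP: x0.
    by rewrite subr_eq0 => /eqP ->.
- by move=> t t01; rewrite loop_cat_clamp//=; case: ifP.
- by move=> t t01; rewrite loop_cat_clamp//=; case: ifP.
- by move=> s _ /=; rewrite mulr0 sub0r lerN10 H0.
- move=> s _ /=; rewrite mulr1 (_ : 2 - 1 = 1 :> R) ?ler10 ?K1//.
  by rewrite -[2]/(1 + 1) addrK.
Qed.

Lemma pi1_mulE (f g : loop) :
  pi1_mul (loop_class f) (loop_class g) = loop_class (loop_cat f g).
Proof.
by apply/loop_classP/loop_homotopic_cat; apply/loop_classP; exact: loop_repK.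
Qed.

Lemma pi1_invE (f : loop) : pi1_inv (loop_class f) = loop_class (loop_rev f).
Proof. by apply/loop_classP/loop_homotopic_rev/loop_classP/loop_repK. Qed.

Let cmin (f g : R -> R) : continuous f -> continuous g ->
  continuous (fun t : R => Num.min (f t) (g t)).
Proof. by move=> cf cg t; apply: continuous_min; [exact: cf|exact: cg]. Qed.

Lemma pi1_mulA : associative pi1_mul.
Proof.
move=> x y z; rewrite -(loop_repK x) -(loop_repK y) -(loop_repK z).
move: (loop_rep x) (loop_rep y) (loop_rep z) => {x y z} f g h.
rewrite !pi1_mulE; apply/loop_classP.
pose u (t : R) := Num.min (Num.min (2 * t) (t + 4^-1)) (2^-1 * t + 2^-1).
apply: (@loop_homotopic_reparam (loop_cat f (loop_cat g h)) _ _ id u).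
- by move=> t.
- apply: cmin; last by apply: continuous_shift; exact: mulrl_continuous.
  by apply: cmin; [exact: mulrl_continuous|by apply: continuous_shift => t].
- by move=> t t01; rewrite clamp_id.
- move=> t t01; have := t01; rewrite /= in_itv /= => /andP[t0 t1].
  have [t4|t4] := leP (4 * t) 1; [|have [t2|t2] := leP (2 * t) 1].
  + have -> : u t = 2 * t.
      by rewrite /u /Num.min; repeat (case: ifPn); rewrite -?leNgt; lra.
    rewrite clamp_id; last by rewrite /= in_itv /=; lra.
    rewrite /= /loop_cat_fun /= /loop_cat_fun.
    by do 2! (rewrite ifT; last lra); rewrite ifT; last lra.
  + have -> : u t = t + 4^-1.
      by rewrite /u /Num.min; repeat (case: ifPn); rewrite -?leNgt; lra.
    rewrite clamp_id; last by rewrite /= in_itv /=; lra.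
    rewrite /= /loop_cat_fun /= /loop_cat_fun.
    rewrite ifT; last lra.
    rewrite ifF; last lra.
    rewrite ifF; last lra.
    rewrite ifT; last lra.
    by congr (g _); lra.
  + have -> : u t = 2^-1 * t + 2^-1.
      by rewrite /u /Num.min; repeat (case: ifPn); rewrite -?leNgt; lra.
    rewrite clamp_id; last by rewrite /= in_itv /=; lra.
    rewrite /= /loop_cat_fun /= /loop_cat_fun.
    do 3! (rewrite ifF; last lra).
    by congr (h _); lra.
- by rewrite /u /Num.min; repeat (case: ifPn); rewrite -?leNgt; lra.
- by rewrite /u /Num.min; repeat (case: ifPn); rewrite -?leNgt; lra.
Qed.

Lemma pi1_mul1 : left_id pi1_one pi1_mul.
Proof.
move=> x; rewrite -(loop_repK x); move: (loop_rep x) => {x} f.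
rewrite pi1_mulE; apply/loop_classP.
apply: (@loop_homotopic_reparam f _ _ (fun t => clamp (2 * t - 1)) id).
- apply: continuous_compfun; last exact: continuous_clamp.
  by apply: continuous_shift; exact: mulrl_continuous.
- by move=> t.
- move=> t t01; rewrite loop_cat_clamp// (clamp_id (clamp_itv _)).
  case: ifPn => //= h; rewrite (_ : clamp (2 * t - 1) = 0) ?loop0//.
  by rewrite /clamp (min_idPr (le_trans h ler01)) (max_idPl h).
- by move=> t t01; rewrite clamp_id.
- rewrite /clamp /Num.min /Num.max.
  by repeat (case: ifPn); rewrite -?leNgt; lra.
- by rewrite mulr1 -[2]/(1 + 1) addrK clamp1.
Qed.

Lemma pi1_mulr1 : right_id pi1_one pi1_mul.
Proof.
move=> x; rewrite -(loop_repK x); move: (loop_rep x) => {x} f.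
rewrite pi1_mulE; apply/loop_classP.
apply: (@loop_homotopic_reparam f _ _ (fun t => clamp (2 * t)) id).
- apply: continuous_compfun; last exact: continuous_clamp.
  exact: mulrl_continuous.
- by move=> t.
- move=> t t01; rewrite loop_cat_clamp// (clamp_id (clamp_itv _)).
  case: ifPn => //= h; rewrite (_ : clamp (2 * t) = 1) ?loop1//.
  rewrite /clamp (min_idPl _) ?(max_idPr ler01)//.
  by move: h; rewrite -ltNge subr_gt0 => /ltW.
- by move=> t t01; rewrite clamp_id.
- by rewrite mulr0 clamp0.
- by rewrite mulr1 /clamp (min_idPl _) ?(max_idPr ler01)// ler1n.
Qed.

Lemma loop_cat_rev (f : loop) :
  loop_homotopic (loop_cat f (loop_rev f)) loop_cst.
Proof.
apply: (@loop_homotopic_reparam f _ _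
  (fun t => Num.min (2 * t) (- 2 * t + 2)) (fun=> 0)).
- by apply: cmin; [exact: mulrl_continuous|apply: continuous_shift; exact: mulrl_continuous].
- exact: cst_continuous.
- move=> t; rewrite /= in_itv /= => /andP[t0 t1].
  rewrite /loop_cat_fun /= /loop_rev_fun.
  have [t2|t2] := leP (2 * t) 1.
  + have -> : Num.min (2 * t) (- 2 * t + 2) = 2 * t.
      by rewrite /Num.min; case: ifPn; rewrite -?leNgt; lra.
    rewrite ifT; last lra.
    by rewrite clamp_id//= in_itv /=; lra.
  + have -> : Num.min (2 * t) (- 2 * t + 2) = - 2 * t + 2.
      by rewrite /Num.min; case: ifPn; rewrite -?leNgt; lra.
    rewrite ifF; last lra.
    rewrite clamp_id; last by rewrite /= in_itv /=; lra.
    by congr (f _); lra.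
- by move=> t _; rewrite clamp0 loop0.
- by rewrite /Num.min; case: ifPn; rewrite -?leNgt; lra.
- by rewrite /Num.min; case: ifPn; rewrite -?leNgt; lra.
Qed.

Lemma pi1_mulV : right_inverse pi1_one pi1_inv pi1_mul.
Proof.
move=> x; rewrite -(loop_repK x); move: (loop_rep x) => {x} f.
by rewrite pi1_invE pi1_mulE; apply/loop_classP/loop_cat_rev.
Qed.

Lemma pi1_mulVl : left_inverse pi1_one pi1_inv pi1_mul.
Proof.
move=> x; rewrite -(pi1_mulr1 (pi1_mul _ _)) -(pi1_mulV (pi1_inv x)).
rewrite pi1_mulA -(pi1_mulA (pi1_inv x)) pi1_mulV.
by rewrite pi1_mulr1 pi1_mulV.
Qed.

HB.instance Definition _ := isGroup.Build pi1
  pi1_mulA pi1_mul1 pi1_mulr1 pi1_mulVl pi1_mulV.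

End FundamentalGroup.

Section Knots.
Variable R : realType.
Local Notation "'R3'" := 'rV[R]_3.
Implicit Types (K : set R3) (c : R -> R3) (h : R3 -> R3).

(* A 1-periodic parametrization of a homeomorphic image of the circle R / Z. *)
Definition circle_embedding c : Prop :=
  [/\ continuous c, forall t, c (t + 1) = c t &
      forall s t, c s = c t -> exists n : int, t = s + n%:~R].

(* Coordinatewise C^oo with nowhere vanishing velocity. *)
Definition smooth_immersion c : Prop :=
  (forall (i : 'I_3) (n : nat) (t : R),
     derivable (derive1n n (fun s => c s 0 i)) t 1) /\
  (forall t, exists i : 'I_3, derive1 (fun s => c s 0 i) t != 0).

Definition piecewise_linear c : Prop :=
  exists (n : nat) (u : nat -> R),
    [/\ u 0%N = 0, u n = 1 &
        forall i : nat, (i < n)%N -> u i < u i.+1 /\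
          forall l : R, 0 <= l <= 1 ->
            c ((1 - l) * u i + l * u i.+1) =
            (1 - l) *: c (u i) + l *: c (u i.+1)].

Definition knot K : Prop :=
  exists c, [/\ circle_embedding c, smooth_immersion c \/ piecewise_linear c &
                range c = K].

Definition self_homeomorphism h : Prop :=
  continuous h /\
  exists k : R3 -> R3, [/\ continuous k, cancel h k & cancel k h].

(* The standard solid torus: core circle of radius 2 in the plane z = 0,
   meridian discs of radius 1. *)
Definition solid_torus : set R3 :=
  [set v | (Num.sqrt (v 0 0 ^+ 2 + v 0 1 ^+ 2) - 2) ^+ 2 + v 0 2%:R ^+ 2 <= 1].

(* The topological boundary of [solid_torus]. *)
Definition solid_torus_surface : set R3 :=
  [set v | (Num.sqrt (v 0 0 ^+ 2 + v 0 1 ^+ 2) - 2) ^+ 2 + v 0 2%:R ^+ 2 = 1].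

(* The point of longitude [x] and meridional angle [y]. *)
Definition torus_point (x y : R) : R3 :=
  \row_(i < 3) nth 0 [:: (2 + cos y) * cos x; (2 + cos y) * sin x; sin y] i.

Lemma torus_point_surface x y : solid_torus_surface (torus_point x y).
Proof.
rewrite /solid_torus_surface /= !mxE /= !exprMn -mulrDr cos2Dsin2 mulr1.
rewrite sqrtr_sqr ger0_norm; last by have := cos_geN1 y; lra.
by rewrite (addrC 2) addrK cos2Dsin2.
Qed.

(* An unknotted solid torus is the image [h @` solid_torus] of the standard one
   under a homeomorphism of R^3. The knot [K] lies on its surface
   and winds [p] times in the longitudinal and [q] times in the meridional
   direction: [x] and [y] are lifts to R of the two angular coordinates. *)
Definition torus_knot (p q : int) K : Prop :=
  knot K /\ exists h,
    [/\ self_homeomorphism h, K `<=` h @` solid_torus_surface &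
        exists (c : R -> R3) (x y : R -> R),
          [/\ circle_embedding c, range c = K,
              continuous x /\ continuous y,
              forall t, c t = h (torus_point (x t) (y t)) &
              forall t, x (t + 1) = x t + 2 * pi * p%:~R /\
                        y (t + 1) = y t + 2 * pi * q%:~R]].

End Knots.

(* Main.v *)
From HB Require Import structures.
Require Import Defs.
From mathcomp Require Import all_boot all_order all_algebra.
From mathcomp Require Import fingroup perm.
From mathcomp Require Import all_classical all_reals all_analysis.
From mathcomp Require Import ring lra zify.
Set Implicit Arguments.
Unset Strict Implicit.
Unset Printing Implicit Defensive.
Import Order.TTheory GRing.Theory Num.Theory numFieldNormedType.Exports.
Local Open Scope classical_set_scope.
Local Open Scope ring_scope.

(** Undoing the homeomorphism [h] turns [K] into a simple closed curve of class
(p, q) on the standard torus T.  Let x run once along the core of the solid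
torus bounded by T, and y once around it, through the hole.  The classical
presentation of the group says that x^p = y^q; what is needed of it is this.

A loop of T that avoids [K] and has class (m, n) in the lattice of T can be
pushed inside, where it becomes x^m because meridians bound discs, and outside,
where it becomes y^n because longitudes bound discs through the hole
([straight_period], [straight_kill]).  So x^m = y^n commutes with y.  If m is
positive and x and y do not commute, then the commutator of x and y is a
generalized torsion element: the product of its conjugates by x^(m-1), ..., x, 1
is the commutator of x^m and y, which is 1 ([torsion_of_commuting_power]).
Three facts remain.

Some loop of T that avoids [K] is not null-homologous in T
([essential_period]), and the class of any such loop is a multiple of (p, q)
([period_multiple]), so that m is not 0.  Since [h] is only a homeomorphism, the
curve has no tubular neighbourhood to start with.  Both facts are obtained in
the universal cover from a statement on the degree of plane maps: a continuous
map f with f (z + e1) = f z + u and f (z + e2) = f z + w, where u and w are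
linearly independent, has a zero ([lattice_zero]).  For the second fact f is the
difference of two lifted curves, which cannot vanish if they are disjoint.  For
the first one, if all loops off [K] were null-homologous, there would be two
functions whose values are never half integers at the same time.

Finally, x and y do not commute.  Take permutations a and b that do not commute
and satisfy a^p = b^q = 1 ([noncommuting_rotations]).  There is a covering of
the complement whose monodromy along x is a power of a, and along y a conjugate
of a power of b: over T minus [K] both pieces are trivial, because classes of
loops are multiples of (p, q) there, and so they can be glued.  This covering is
described by the transport [torus_cocycle] between fibres over nearby points.
Invariance of the monodromy under homotopy ([monodromy_square]) holds for any
such local cocycle; winding numbers of plane curves, on which [lattice_zero]
rests, are the other instance. *)

(** * Generalized torsion and integer powers *)

Section Torsion.
Local Open Scope group_scope.

Lemma prod_conj_pow (G : groupType) (x c : G) n :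
  \big[*%g/1]_(i < n) c ^ (x ^+ (n - i.+1)%N) = x ^- n * (x * c) ^+ n.
Proof.
elim: n => [|n IH]; first by rewrite big_ord0 expg0 invg1 mulg1.
rewrite big_ord_recr /= subnn conjg1.
have -> : \big[*%g/1]_(i < n) c ^ (x ^+ (n.+1 - i.+1)%N) =
          (\big[*%g/1]_(i < n) c ^ (x ^+ (n - i.+1)%N)) ^ x.
  rewrite conjg_prod; apply: eq_bigr => i _; rewrite -conjgM -expgSr.
  by rewrite subSS subnSK// ltn_ord.
rewrite IH conjgE expgSr expgSr invgM !mulgA.
by rewrite -!mulgA.
Qed.

(** With c the commutator of x and y, one has x * c = x ^ y, so the product of the
conjugates in [prod_conj_pow] is x^-m * (x^m)^y. *)
Lemma torsion_of_commuting_power (G : groupType) (x y : G) m :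
  (0 < m)%N -> commute (x ^+ m) y -> ~ commute x y ->
  exists g : G, generalized_torsion g.
Proof.
move=> m0 xmy xy; exists [~ x, y]; split.
  by move/eqP/commgP; exact: xy.
exists m, (fun i : 'I_m => x ^+ (m - i.+1)%N); split => //.
rewrite prod_conj_pow commgEl mulVKg.
by rewrite -conjXg conjgE xmy mulKg mulVg.
Qed.

End Torsion.

Lemma int_hom0 (G : groupType) (h : int -> G) :
  (forall m n, h (m + n) = (h m * h n)%g) -> h 0 = 1%g.
Proof. by move=> hD; apply: (mulgI (h 0)); rewrite -hD addr0 mulg1. Qed.

Lemma int_homN (G : groupType) (h : int -> G) :
  (forall m n, h (m + n) = (h m * h n)%g) -> forall m, h (- m) = ((h m)^-1)%g.
Proof.
by move=> hD m; apply: (mulgI (h m)); rewrite -hD subrr (int_hom0 hD) mulgV.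
Qed.

Lemma int_hom_pow (G : groupType) (h : int -> G) :
  (forall m n, h (m + n) = (h m * h n)%g) -> forall n : nat, h n%:Z = (h 1%R ^+ n)%g.
Proof.
move=> hD; elim=> [|n IH]; first exact: int_hom0.
by rewrite expgS -IH -hD; congr h; lia.
Qed.

Lemma int_hom_trivial (G : groupType) (h : int -> G) :
  (forall m n, h (m + n) = (h m * h n)%g) -> h 1 = 1%g -> forall n, h n = 1%g.
Proof.
move=> hD h1 [n|n]; first by rewrite int_hom_pow// h1 expg1n.
by rewrite NegzE (int_homN hD) int_hom_pow// h1 expg1n invg1.
Qed.

Section Rotations.
Variables P Q : nat.
Let T := ('Z_P * 'Z_Q)%type.
Implicit Types (k : int) (z : T).

Definition rot_fst_fun k z : T := (z.1 + k%:~R, z.2).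
(** Rotating only the fibre over 0 is what prevents this map from commuting with a
rotation of the base. *)
Definition rot_snd_fun k z : T := (z.1, if z.1 == 0 then z.2 + k%:~R else z.2).

Lemma rot_fst_inj k : injective (rot_fst_fun k).
Proof.
apply: (can_inj (g := rot_fst_fun (- k))) => -[i j].
by rewrite /rot_fst_fun intrN addrK.
Qed.

Lemma rot_snd_inj k : injective (rot_snd_fun k).
Proof.
apply: (can_inj (g := rot_snd_fun (- k))) => -[i j].
have E m x y : rot_snd_fun m (x, y) = (x, if x == 0 then y + m%:~R else y) by [].
by rewrite !E intrN; case: (i == 0); rewrite // addrK.
Qed.

Definition rot_fst k : {perm T} := perm (@rot_fst_inj k).
Definition rot_snd k : {perm T} := perm (@rot_snd_inj k).

Lemma rot_fstD m n : rot_fst (m + n) = (rot_fst m * rot_fst n)%g.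
Proof.
by apply/permP => z; rewrite permM !permE /rot_fst_fun /= intrD addrA.
Qed.

Lemma rot_sndD m n : rot_snd (m + n) = (rot_snd m * rot_snd n)%g.
Proof.
apply/permP => z; rewrite permM !permE /rot_snd_fun /=.
by case: ifP; rewrite // intrD addrA.
Qed.

Lemma intr_Zp n k : (1 < n)%N -> (n%:Z * k)%:~R = 0 :> 'Z_n.
Proof.
move=> n1; rewrite intrM; have -> : (n%:Z)%:~R = n%:R :> 'Z_n by [].
by rewrite pchar_Zp// mul0r.
Qed.

End Rotations.

(** A finite quotient of the torus knot group: x^p = y^q holds in it because both
sides are 1.  The powers of the two generators are indexed by integers. *)
Lemma noncommuting_rotations (p q : int) : 1 < `|p| -> 1 < `|q| ->
  exists (S : groupType) (a b : int -> S),
    [/\ forall m n, a (m + n) = (a m * a n)%g,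
        forall m n, b (m + n) = (b m * b n)%g,
        forall k, a (p * k) = 1%g, forall k, b (q * k) = 1%g &
        (a (- 1) * b (- 1))%g <> (b (- 1) * a (- 1))%g].
Proof.
move=> p1 q1; pose P := `|p|%N; pose Q := `|q|%N.
have P1 : (1 < P)%N by rewrite /P; lia.
have Q1 : (1 < Q)%N by rewrite /Q; lia.
exists {perm 'Z_P * 'Z_Q}, (@rot_fst P Q), (@rot_snd P Q); split.
- exact: rot_fstD.
- exact: rot_sndD.
- move=> k; apply/permP => z; rewrite permE perm1 /rot_fst_fun.
  have -> : p * k = P%:Z * (sgz p * k) by rewrite mulrA mulrC /P abszE; lia.
  by rewrite intr_Zp// addr0; case: z.
- move=> k; apply/permP => z; rewrite permE perm1 /rot_snd_fun.
  have -> : q * k = Q%:Z * (sgz q * k) by rewrite mulrA mulrC /Q abszE; lia.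
  by rewrite intr_Zp// addr0; case: z => i j /=; case: ifP.
- have Ea m x y : rot_fst P Q m (x, y) = (x + m%:~R, y) by rewrite permE.
  have Eb m x y : rot_snd P Q m (x, y) = (x, if x == 0 then y + m%:~R else y).
    by rewrite permE.
  have N1 n : (1 < n)%N -> (- 1)%:~R != 0 :> 'Z_n.
    by move=> n1; rewrite intrN oppr_eq0 oner_neq0.
  (* at (0, 0) the second rotation acts if it comes first, and not after the other *)
  move=> /permP /(_ (0, 0)); rewrite !permM Ea !Eb Ea !add0r.
  rewrite (negbTE (N1 _ P1)) => h.
  have h2 : 0 = (-1)%:~R :> 'Z_Q := congr1 snd h.
  by have := N1 _ Q1; rewrite -h2 eqxx.
Qed.

(** * Continuity of real-valued functions *)

Section ContinuousReal.
Variables (R : realType) (U : topologicalType).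
Implicit Types f g : U -> R.

Lemma continuous_constfun (c : R) : continuous (fun _ : U => c).
Proof. by move=> x; exact: cst_continuous. Qed.

Lemma continuous_addfun f g : continuous f -> continuous g -> continuous (fun x => f x + g x).
Proof. by move=> cf cg x; exact: (continuousD (cf x) (cg x)). Qed.

Lemma continuous_oppfun f : continuous f -> continuous (fun x => - f x).
Proof. by move=> cf x; exact: (continuousN (cf x)). Qed.

Lemma continuous_mulfun f g : continuous f -> continuous g -> continuous (fun x => f x * g x).
Proof. by move=> cf cg x; exact: (continuousM (cf x) (cg x)). Qed.

Lemma continuous_cosfun f : continuous f -> continuous (fun x => cos (f x)).
Proof. by move=> cf; apply: (continuous_compfun cf); exact: continuous_cos. Qed.

Lemma continuous_sinfun f : continuous f -> continuous (fun x => sin (f x)).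
Proof. by move=> cf; apply: (continuous_compfun cf); exact: continuous_sin. Qed.

Lemma continuous_normfun f : continuous f -> continuous (fun x => `|f x|).
Proof. by move=> cf x; exact: cvg_norm (cf x). Qed.

End ContinuousReal.

Arguments continuous_constfun {R U} c.

Lemma continuous_fstfun (R : realType) (U : topologicalType) (f : U -> R * R) :
  continuous f -> continuous (fun x => (f x).1).
Proof. by move=> cf; apply: (continuous_compfun cf); exact: continuous_fst. Qed.

Lemma continuous_sndfun (R : realType) (U : topologicalType) (f : U -> R * R) :
  continuous f -> continuous (fun x => (f x).2).
Proof. by move=> cf; apply: (continuous_compfun cf); exact: continuous_snd. Qed.

Lemma continuous_idfun (R : realType) : continuous (fun x : R => x).
Proof. by move=> x. Qed.

Lemma continuous_id2fun (R : realType) : continuous (fun x : R * R => x).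
Proof. by move=> x. Qed.

Ltac prove_continuous := repeat (cbv beta;
  lazymatch goal with
  | |- forall x, continuous_at x ?F =>
    lazymatch F with
    | (fun _ => ?c) => apply: (continuous_constfun c)
    | (fun u => u) => first [apply: continuous_idfun | apply: continuous_id2fun]
    | (fun u => @Algebra.add _ (@?f u) (@?g u)) => apply: (continuous_addfun (f := f) (g := g))
    | (fun u => @Algebra.opp _ (@?f u)) => apply: (continuous_oppfun (f := f))
    | (fun u => @GRing.mul _ (@?f u) (@?g u)) => apply: (continuous_mulfun (f := f) (g := g))
    | (fun u => @cos _ (@?f u)) => apply: (continuous_cosfun (f := f))
    | (fun u => @sin _ (@?f u)) => apply: (continuous_sinfun (f := f))
    | (fun u => @pair _ _ (@?f u) (@?g u)) =>
        apply: (continuous_pairfun (f := f) (g := g))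
    | (fun u => @fst _ _ (@?f u)) => apply: (continuous_fstfun (f := f))
    | (fun u => @snd _ _ (@?f u)) => apply: (continuous_sndfun (f := f))
    | @GRing.mul _ _ => exact: mulrl_continuous
    | @clamp _ => exact: continuous_clamp
    | @fst _ _ => exact: continuous_fst
    | @snd _ _ => exact: continuous_snd
    | (fun u => @clamp _ (@?f u)) =>
        apply: (continuous_compfun (f := f) _ (@continuous_clamp _))
    | _ => assumption
    end
  end).

(** * Monodromy of a local cocycle *)

Section Cousin.
Variable R : realType.

(** Cousin's principle.  The supremum of the [v] such that [P a v] can only be [b],
since the local hypothesis carries [P a] beyond any smaller point. *)
Lemma interval_subdivision (a b : R) (P : R -> R -> Prop) : a <= b ->
  (forall u v w, a <= u <= v -> v <= w <= b -> P u v -> P v w -> P u w) ->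
  (forall x, a <= x <= b -> exists2 e, 0 < e &
     forall u v, a <= u <= v -> v <= b -> `|u - x| < e -> `|v - x| < e ->
     P u v) ->
  P a b.
Proof.
move=> ab Padd Ploc.
pose A := [set v : R | a <= v <= b /\ P a v].
have A0 : A a.
  have [|e e0 Pe] := Ploc a; first by rewrite lexx ab.
  by split; rewrite ?lexx ?ab//; apply: Pe; rewrite ?subrr ?normr0 ?lexx ?ab.
have ubA : ubound A b by move=> v [/andP[]].
have supA : has_sup A by split; [exists a|exists b].
set c := sup A.
have c0 : a <= c by apply: sup_upper_bound.
have c1 : c <= b by apply: ge_sup => //; exists a.
have [|e e0 Pe] := Ploc c; first by rewrite c0.
have [v [v01 Pv] vc] := sup_adherent e0 supA.
have lvc : v <= c by apply: sup_upper_bound.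
move: v01 => /andP[v0 v1]; rewrite -/c in vc.
pose w := Num.min b (c + e / 2).
have wle : w <= b by rewrite /w ge_min lexx.
have vw : v <= w by rewrite le_min v1 /=; lra.
have cw : w <= c + e / 2 by rewrite /w ge_min lexx orbT.
have lcw : c <= w by rewrite le_min c1 /=; lra.
have Aw : A w.
  split; first by rewrite (le_trans v0 vw).
  apply: (Padd a v w); rewrite ?lexx ?v0 ?vw//.
  by apply: Pe; rewrite ?v0 ?vw// ltr_norml; lra.
have : w <= c by apply: sup_upper_bound.
rewrite {1}/w ge_min => /orP[c1'|]; last lra.
have <- : w = b by lra.
by case: Aw.
Qed.

End Cousin.

Section Cocycle.
Variables (R : realType) (S : groupType) (X : topologicalType).
Variable tau : X -> X -> S.
Local Open Scope group_scope.

(** With [tau x y] read as the transport from the fibre over [x] to the fibre over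
[y], this is flatness over [A]. *)
Definition cocycle_on (A : set X) :=
  forall x y z, A x -> A y -> A z -> tau x y * tau y z = tau x z.

Definition cocycle_near (x : X) := exists2 A, nbhs x A & cocycle_on A.

Lemma cocycle_refl A x : cocycle_on A -> A x -> tau x x = 1.
Proof. by move=> cA Ax; apply: (mulgI (tau x x)); rewrite cA// mulg1. Qed.

(** A lift of the path [g] to the covering whose transport is [tau]. *)
Definition potential (g : R -> X) (u v : R) (s : R -> S) :=
  forall t0, (u <= t0 <= v)%R -> exists2 e : R, (0 < e)%R &
    forall t, (u <= t <= v)%R -> (`|t - t0| < e)%R ->
      s t = s t0 * tau (g t0) (g t).

Lemma sub_potential g u v u' v' s :
  (u <= u')%R -> (v' <= v)%R -> potential g u v s -> potential g u' v' s.
Proof.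
move=> uu vv ps t0 /andP[ut tv].
have [|e e0 He] := ps t0; first by rewrite (le_trans uu) ?(le_trans _ vv).
exists e => // t /andP[ut' tv'] tt.
by apply: He => //; rewrite (le_trans uu) ?(le_trans _ vv).
Qed.

Lemma potential_cat g u v w s1 s2 : (u <= v <= w)%R ->
  potential g u v s1 -> potential g v w s2 ->
  potential g u w
    (fun t => if (t <= v)%R then s1 t else s1 v * (s2 v)^-1 * s2 t).
Proof.
move=> /andP[uv vw] p1 p2 t0 /andP[ut tw].
have [tv|vt|tv] := ltgtP t0 v.
- have [|e e0 He] := p1 t0; first by rewrite ut ltW.
  exists (Num.min e (v - t0)%R); first by rewrite lt_min e0; lra.
  move=> t /andP[u1 w1]; rewrite lt_min => /andP[h1]; rewrite ltr_norml => h2.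
  by rewrite ifT; [apply: He => //; rewrite u1 /=|]; lra.
- have [|e e0 He] := p2 t0; first by rewrite tw ltW.
  exists (Num.min e (t0 - v)%R); first by rewrite lt_min e0; lra.
  move=> t /andP[u1 w1]; rewrite lt_min => /andP[h1]; rewrite ltr_norml => h2.
  rewrite ifF; last lra.
  by rewrite (He t) ?mulgA//; rewrite w1; lra.
- subst t0.
  have [|e e0 He] := p1 v; first by rewrite ut lexx.
  have [|e' e'0 He'] := p2 v; first by rewrite tw lexx.
  exists (Num.min e e'); first by rewrite lt_min e0.
  move=> t /andP[u1 w1]; rewrite lt_min => /andP[h1 h2].
  case: (leP t v) => tv; first by apply: He; rewrite ?u1.
  by rewrite (He' t) ?w1 ?ltW// mulgA mulgVK.
Qed.

Lemma cocycle_near_path (g : R -> X) x : continuous g -> cocycle_near (g x) ->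
  exists2 e : R, (0 < e)%R &
    exists2 A, cocycle_on A & forall t, (`|t - x| < e)%R -> A (g t).
Proof.
move=> cg [A nA cA]; have /(cg x) /= /nbhs_ballP[e /= e0 He] := nA.
by exists e => //; exists A => // t tx; apply: He; rewrite /ball /= distrC.
Qed.

Lemma potential_ex (g : R -> X) : continuous g ->
  (forall t, (0 <= t <= 1)%R -> cocycle_near (g t)) ->
  exists s, potential g 0 1 s.
Proof.
move=> cg Lg; apply: (@interval_subdivision R 0%R 1%R
  (fun u v => exists s, potential g u v s)) => //.
  move=> u v w /andP[_ uv] /andP[vw _] [s1 p1] [s2 p2].
  by eexists; apply: (potential_cat _ p1 p2); rewrite uv.
move=> x /Lg /(cocycle_near_path cg)[e e0 [A cA Ae]].
exists e => // u v /andP[u0 uv] v1 ux vx.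
exists (fun t => tau (g u) (g t)) => t0 /andP[ut0 t0v]; exists 1%R => // t /andP[ut tv] _.
move: ux vx; rewrite !ltr_norml => ux vx.
by rewrite cA//; apply: Ae; rewrite ltr_norml; lra.
Qed.

Lemma potential_unique g u v s s' : (u <= v)%R ->
  potential g u v s -> potential g u v s' -> (s u)^-1 * s v = (s' u)^-1 * s' v.
Proof.
move=> uv p p'.
apply: (@interval_subdivision R u v
  (fun u v => (s u)^-1 * s v = (s' u)^-1 * s' v)) => //.
  move=> a b c _ _ h1 h2.
  have E (z : R -> S) : (z a)^-1 * z c = ((z a)^-1 * z b) * ((z b)^-1 * z c).
    by rewrite -mulgA mulVKg.
  by rewrite !E h1 h2.
move=> x x01; have [e e0 He] := p x x01; have [e' e'0 He'] := p' x x01.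
exists (Num.min e e'); first by rewrite lt_min e0.
move=> a b /andP[ua ab] bv; rewrite !lt_min => /andP[a1 a2] /andP[b1 b2].
have a3 : (u <= a <= v)%R by rewrite ua (le_trans ab).
have b3 : (u <= b <= v)%R by rewrite (le_trans ua).
by rewrite (He a)// (He b)// (He' a)// (He' b)// !invgM -!mulgA !mulKg.
Qed.

Definition regular_path (g : R -> X) :=
  continuous g /\ forall t, (0 <= t <= 1)%R -> cocycle_near (g t).

(** Two potentials of a regular path differ by a constant on the left
([potential_unique]), so the choice made here does not matter. *)
Definition monodromy (g : R -> X) (u v : R) : S :=
  let s := xget (fun=> 1) [set s | potential g 0 1 s] in (s u)^-1 * s v.

Lemma monodromy_potential g u v s : regular_path g ->
  (0 <= u <= v)%R -> (v <= 1)%R -> potential g u v s ->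
  monodromy g u v = (s u)^-1 * s v.
Proof.
move=> [cg Lg] /andP[u0 uv] v1 ps; rewrite /monodromy.
have [s0 ps0] := potential_ex cg Lg.
apply: (@potential_unique g) => //.
apply: (@sub_potential g 0%R 1%R) => //.
by case: xgetP => // /(_ s0).
Qed.

Lemma monodromyM g u v w : monodromy g u v * monodromy g v w = monodromy g u w.
Proof. by rewrite /monodromy -mulgA mulVKg. Qed.

Lemma monodromy_cocycle g u v A : regular_path g ->
  (0 <= u <= v)%R -> (v <= 1)%R -> cocycle_on A ->
  (forall t, (u <= t <= v)%R -> A (g t)) ->
  monodromy g u v = tau (g u) (g v).
Proof.
move=> rg uv v1 cA Ag; have uv' := uv; move: uv' => /andP[u0 luv].
rewrite (@monodromy_potential g u v (fun t => tau (g u) (g t)))//; last first.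
  move=> t0 t0uv; exists 1%R => // t tuv _.
  by rewrite cA//; apply: Ag => //; rewrite lexx.
by rewrite (cocycle_refl cA) ?invg1 ?mul1g//; apply: Ag; rewrite lexx.
Qed.

Lemma monodromy_affine f g u v : regular_path f -> regular_path g ->
  (0 <= u)%R -> (u < v)%R -> (v <= 1)%R ->
  (forall t, (0 <= t <= 1)%R -> f t = g ((v - u) * t + u)%R) ->
  monodromy f 0 1 = monodromy g u v.
Proof.
move=> rf rg u0 uv v1 fg; have a0 : (0 < v - u)%R by rewrite subr_gt0.
have [s ps] := potential_ex rg.1 rg.2.
rewrite (@monodromy_potential g u v s)//; first last.
- exact: (@sub_potential g 0%R 1%R).
- by rewrite u0 ltW.
have in01 t : (0 <= t <= 1)%R -> (0 <= (v - u) * t + u <= 1)%R by nra.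
rewrite (@monodromy_potential f 0%R 1%R (fun t => s ((v - u) * t + u)%R)) ?lexx ?ler01//.
  by rewrite mulr0 mulr1 add0r subrK.
move=> t0 t01; have [e e0 He] := ps _ (in01 _ t01).
exists (e / (v - u))%R; first by rewrite divr_gt0.
move=> t t1 tt; rewrite !fg//; apply: He; first exact: in01.
have -> : ((v - u) * t + u - ((v - u) * t0 + u) = (v - u) * (t - t0))%R by lra.
by rewrite normrM (gtr0_norm a0) mulrC -ltr_pdivlMr.
Qed.

(** On a square that is mapped to a flat set both sides are the transport along the
diagonal, and the equation is preserved when rectangles are put side by side. *)
Lemma monodromy_square (H : R * R -> X) : continuous H ->
  (forall s t, (0 <= s <= 1)%R -> (0 <= t <= 1)%R -> cocycle_near (H (s, t))) ->
  monodromy (fun t => H (0, t)%R) 0 1 * monodromy (fun s => H (s, 1)%R) 0 1 =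
  monodromy (fun s => H (s, 0)%R) 0 1 * monodromy (fun t => H (1, t)%R) 0 1.
Proof.
move=> cH LH.
have rr s : (0 <= s <= 1)%R -> regular_path (fun t => H (s, t)).
  move=> s01; split; last by move=> t; exact: LH.
  apply: (continuous_compfun _ cH); apply: continuous_pairfun.
    exact: cst_continuous.
  by move=> x.
have rc t : (0 <= t <= 1)%R -> regular_path (fun s => H (s, t)).
  move=> t01; split; last by move=> s s01; exact: LH.
  apply: (continuous_compfun _ cH); apply: continuous_pairfun; last first.
    exact: cst_continuous.
  by move=> x.
pose Q u v c d := monodromy (fun t => H (u, t)) c d * monodromy (fun s => H (s, d)) u v =
  monodromy (fun s => H (s, c)) u v * monodromy (fun t => H (v, t)) c d.
apply: (@interval_subdivision R 0%R 1%R (fun c d => Q 0%R 1%R c d)) => //.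
  move=> c d e _ _; rewrite /Q => h1 h2.
  by rewrite -(monodromyM _ c d e) -mulgA h2 mulgA h1 -mulgA monodromyM.
move=> y y01.
pose P u v := exists2 e : R, (0 < e)%R & forall c d, (0 <= c <= d)%R -> (d <= 1)%R ->
  (`|c - y| < e)%R -> (`|d - y| < e)%R -> Q u v c d.
suff [e e0 He] : P 0%R 1%R by exists e.
apply: (@interval_subdivision R 0%R 1%R P) => //.
  move=> u v w _ _ [e e0 He] [e' e'0 He']; exists (Num.min e e').
    by rewrite lt_min e0.
  move=> c d cd d1; rewrite !lt_min => /andP[h1 h2] /andP[h3 h4].
  have := He c d cd d1 h1 h3; have := He' c d cd d1 h2 h4; rewrite /Q => k2 k1.
  by rewrite -(monodromyM _ u v w) mulgA k1 -mulgA k2 mulgA monodromyM.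
move=> x x01; have [A nA cA] := LH x y x01 y01.
have /(cH (x, y)) /= /nbhs_ballP[e /= e0 He] := nA.
exists e => // u v /andP[u0 uv] v1 ux vx; exists e => // c d /andP[c0 cd] d1 cy dy.
have AH s t : (u <= s <= v)%R -> (c <= t <= d)%R -> A (H (s, t)).
  move=> us ct; apply: He; split; rewrite /ball /=;
  move: ux vx cy dy; rewrite !ltr_norml; lra.
rewrite /Q !(@monodromy_cocycle _ _ _ A) ?u0 ?c0 ?v1 ?d1 //.
- by rewrite !cA //; apply: AH; rewrite ?lexx ?uv ?cd.
- by apply: rr; lra.
- by move=> t tt; apply: AH => //; rewrite lexx uv.
- by apply: rc; lra.
- by move=> t tt; apply: AH => //; rewrite lexx cd.
- by apply: rc; lra.
- by move=> t tt; apply: AH => //; rewrite lexx cd.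
- by apply: rr; lra.
- by move=> t tt; apply: AH => //; rewrite lexx uv.
Qed.

End Cocycle.

(** * Angles of plane vectors *)

Section Angles.
Variable R : realType.
Implicit Types (v w : R * R) (a b phi x : R) (k : int).

Lemma sincosD2piZ x k :
  cos (x + 2 * pi * k%:~R) = cos x /\ sin (x + 2 * pi * k%:~R) = sin x.
Proof.
have H (y : R) n : cos (y + 2 * pi * n%:R) = cos y /\ sin (y + 2 * pi * n%:R) = sin y.
  have -> : 2 * pi * n%:R = (pi *+ 2) *+ n :> R by rewrite -[RHS]mulr_natr -(mulr_natl pi).
  by split; [exact: (periodicn (@cosD2pi R))|exact: (periodicn (@sinD2pi R))].
case: k => n; first exact: H.
rewrite NegzE; have [h1 h2] := H (x + 2 * pi * (- n.+1%:Z)%:~R) n.+1.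
by rewrite -h1 -h2 mulrNz mulrN addrNK.
Qed.

Lemma cosD2piZ x k : cos (x + 2 * pi * k%:~R) = cos x.
Proof. by have [] := sincosD2piZ x k. Qed.

Lemma sinD2piZ x k : sin (x + 2 * pi * k%:~R) = sin x.
Proof. by have [] := sincosD2piZ x k. Qed.

Lemma cos_eq1 x : cos x = 1 -> exists k, x = 2 * pi * k%:~R.
Proof.
move=> c1; have p0 := @pi_gt0 R.
exists (Num.floor (x / (2 * pi))); set k := Num.floor _.
pose y := x - 2 * pi * k%:~R.
have cy : cos y = 1 by rewrite /y -mulrN -mulrNz cosD2piZ.
have y0 : 0 <= y.
  by rewrite subr_ge0 mulrC -ler_pdivlMr ?mulr_gt0// floor_le.
have y2 : y < 2 * pi.
  rewrite ltrBlDl -{2}(mulr1 (2 * pi)) -mulrDr mulrC -ltr_pdivrMr ?mulr_gt0//.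
  by rewrite -intrD1 floorD1_gt.
move: y0; rewrite le_eqVlt => /orP[/eqP y0|y0]; first by move: y0; rewrite /y; lra.
have s0 : 0 < sin (y / 2) by apply: sin_gt0_pi; lra.
have E := cosD (y / 2) (y / 2); have E2 := cos2Dsin2 (y / 2).
have yy : y / 2 + y / 2 = y by lra.
rewrite yy cy -!expr2 in E.
have := exprn_gt0 2 s0; lra.
Qed.

Definition has_angle v a := exists2 r, 0 < r & v = (r * cos a, r * sin a).

Lemma has_angle_unique v a b : has_angle v a -> has_angle v b ->
  exists k, b = a + 2 * pi * k%:~R.
Proof.
move=> [r r0 ->] [s s0] [ec es].
have rs : r = s.
  apply/eqP; rewrite -(@eqrXn2 _ 2) ?ltW//; apply/eqP.
  have E (z c : R) : z ^+ 2 = (z * cos c) ^+ 2 + (z * sin c) ^+ 2.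
    by rewrite !exprMn -mulrDr cos2Dsin2 mulr1.
  by rewrite (E r a) (E s b) ec es.
subst s; have {}ec : cos a = cos b by apply: (mulfI (lt0r_neq0 r0)).
have {}es : sin a = sin b by apply: (mulfI (lt0r_neq0 r0)).
have [|k hk] := @cos_eq1 (b - a); last by exists k; lra.
by rewrite cosB ec es -!expr2 cos2Dsin2.
Qed.

Lemma has_angleD2piZ v a k : has_angle v a -> has_angle v (a + 2 * pi * k%:~R).
Proof. by move=> [r r0 ->]; exists r => //; rewrite cosD2piZ sinD2piZ. Qed.

Definition dotdir phi v := v.1 * cos phi + v.2 * sin phi.
Definition crossdir phi v := v.2 * cos phi - v.1 * sin phi.
(** The angle of [v] within pi / 2 of [phi], for [v] in the open half plane of
direction [phi]. *)
Definition angle_from phi v := phi + atan (crossdir phi v / dotdir phi v).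

Lemma angle_fromP phi v : 0 < dotdir phi v ->
  has_angle v (angle_from phi v) /\ `|angle_from phi v - phi| < pi / 2.
Proof.
move=> d0; split; last first.
  by rewrite /angle_from addrAC subrr add0r ltr_norml atan_gtNpi2 atan_ltpi2.
rewrite /angle_from; set z := crossdir phi v / dotdir phi v.
exists (dotdir phi v * Num.sqrt (1 + z ^+ 2)).
  by rewrite mulr_gt0// sqrtr_gt0 ltr_pwDl// sqr_ge0.
have q0 : 0 < Num.sqrt (1 + z ^+ 2) by rewrite sqrtr_gt0 ltr_pwDl// sqr_ge0.
have ca : Num.sqrt (1 + z ^+ 2) * cos (atan z) = 1.
  by rewrite cos_atan mulfV// lt0r_neq0.
have sa : Num.sqrt (1 + z ^+ 2) * sin (atan z) = z.
  have cn0 : cos (atan z) != 0.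
    by apply/eqP => c0; move: ca; rewrite c0 mulr0 => /eqP; rewrite eq_sym oner_eq0.
  have : tan (atan z) = z by rewrite atanK.
  rewrite /tan => /(canRL (mulfVK cn0)) ->.
  by rewrite mulrCA ca mulr1.
have dz : dotdir phi v * z = crossdir phi v by rewrite mulrC mulfVK// lt0r_neq0.
rewrite cosD sinD.
have -> : dotdir phi v * Num.sqrt (1 + z ^+ 2) *
    (cos phi * cos (atan z) - sin phi * sin (atan z)) =
  dotdir phi v * (Num.sqrt (1 + z ^+ 2) * cos (atan z)) * cos phi -
  dotdir phi v * (Num.sqrt (1 + z ^+ 2) * sin (atan z)) * sin phi by ring.
have -> : dotdir phi v * Num.sqrt (1 + z ^+ 2) *
    (sin phi * cos (atan z) + cos phi * sin (atan z)) =
  dotdir phi v * (Num.sqrt (1 + z ^+ 2) * cos (atan z)) * sin phi +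
  dotdir phi v * (Num.sqrt (1 + z ^+ 2) * sin (atan z)) * cos phi by ring.
rewrite ca sa mulr1 dz /dotdir /crossdir; case: v {d0 z q0 ca sa dz} => v1 v2 /=.
have c2 := cos2Dsin2 phi.
congr (_, _).
  have -> : (v1 * cos phi + v2 * sin phi) * cos phi -
    (v2 * cos phi - v1 * sin phi) * sin phi =
    v1 * (cos phi ^+ 2 + sin phi ^+ 2) by ring.
  by rewrite c2 mulr1.
have -> : (v1 * cos phi + v2 * sin phi) * sin phi +
    (v2 * cos phi - v1 * sin phi) * cos phi =
    v2 * (cos phi ^+ 2 + sin phi ^+ 2) by ring.
by rewrite c2 mulr1.
Qed.

Lemma dotdir_angle phi v a : has_angle v a -> `|a - phi| < pi / 2 ->
  0 < dotdir phi v.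
Proof.
move=> [r r0 ->]; rewrite ltr_norml => /andP[h1 h2]; rewrite /dotdir /=.
have -> : r * cos a * cos phi + r * sin a * sin phi = r * cos (a - phi).
  by rewrite cosB; ring.
by rewrite mulr_gt0// cos_gt0_pihalf// h1.
Qed.

Lemma angle_from_id v a : has_angle v a -> angle_from a v = a.
Proof.
move=> [r r0 ->]; rewrite /angle_from /crossdir /=.
have -> : r * sin a * cos a - r * cos a * sin a = 0 by ring.
by rewrite mul0r atan0 addr0.
Qed.

Lemma has_angle_close v a b : has_angle v a -> has_angle v b ->
  `|a - b| < 2 * pi -> a = b.
Proof.
move=> ha hb; have [k ->] := has_angle_unique ha hb.
rewrite opprD addrA subrr add0r normrN normrM gtr0_norm ?mulr_gt0 ?pi_gt0//.
rewrite -{2}(mulr1 (2 * pi)) ltr_pM2l ?mulr_gt0 ?pi_gt0// => k1.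
suff -> : k = 0 by rewrite mulr0 addr0.
by move: k1; rewrite -intr_norm -[1]/(1%:~R) ltr_int; lia.
Qed.

Lemma has_angle_ex v : v != (0, 0) -> exists a, has_angle v a.
Proof.
move=> v0.
have H phi : 0 < dotdir phi v -> exists a, has_angle v a.
  by move=> /angle_fromP[ha _]; exists (angle_from phi v).
have [v1|v1|v1] := ltgtP v.1 0.
- by apply: (H pi); rewrite /dotdir cospi sinpi; lra.
- by apply: (H 0); rewrite /dotdir cos0 sin0; lra.
have [v2|v2|v2] := ltgtP v.2 0.
- by apply: (H (- (pi / 2))); rewrite /dotdir cosN sinN cos_pihalf sin_pihalf; lra.
- by apply: (H (pi / 2)); rewrite /dotdir cos_pihalf sin_pihalf; lra.
by case: v {H} v0 v1 v2 => x y /= v0 x0 y0; rewrite x0 y0 eqxx in v0.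
Qed.

Lemma continuous_dotdir phi : continuous (dotdir phi).
Proof. rewrite /dotdir; prove_continuous. Qed.

Lemma continuous_crossdir phi : continuous (crossdir phi).
Proof. rewrite /crossdir; prove_continuous. Qed.

Lemma continuous_angle_from phi v : 0 < dotdir phi v ->
  {for v, continuous (angle_from phi)}.
Proof.
move=> d0; apply: continuousD; first exact: cst_continuous.
apply: continuous_comp; last exact: continuous_atan.
apply: continuousM; first exact: continuous_crossdir.
by apply: continuousV; [rewrite lt0r_neq0|exact: continuous_dotdir].
Qed.

(** This is the continuity of [angle_from a] at [v]. *)
Lemma near_angle v a e : has_angle v a -> 0 < e ->
  nbhs v [set w | exists2 b, has_angle w b & `|b - a| < e].
Proof.
move=> ha e0.
have d0 : 0 < dotdir a v.
  by apply: dotdir_angle ha _; rewrite subrr normr0 divr_gt0 ?pi_gt0.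
have n1 : \forall w \near v, 0 < dotdir a w.
  exact: (cvgr_gt _ (@continuous_dotdir a v) _ d0).
have n2 : \forall w \near v, `|angle_from a w - a| < e.
  have : (angle_from a w) @[w --> v] --> angle_from a v := continuous_angle_from d0.
  rewrite [X in _ --> X](angle_from_id ha).
  by move=> /cvgrPdist_lt /(_ e e0); apply: filterS => w; rewrite distrC.
apply: filterS2 n1 n2 => w w1 w2; exists (angle_from a w) => //.
by case: (angle_fromP w1).
Qed.

Definition arg v := xget 0 [set a | has_angle v a].

Lemma argP v a : has_angle v a -> has_angle v (arg v).
Proof. by move=> ha; rewrite /arg; case: xgetP => // /(_ a). Qed.

(** The number of turns from the angle [a] of [v] to its chosen angle [arg v]. *)
Definition lag v a : int := Num.floor ((arg v - a) / (2 * pi)).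

Lemma floor_2pi k : Num.floor (2 * pi * k%:~R / (2 * pi) : R) = k.
Proof.
by rewrite mulrAC mulfV ?mul1r ?intrKfloor// mulf_neq0// lt0r_neq0// pi_gt0.
Qed.

Lemma lagP v a : has_angle v a -> arg v = a + 2 * pi * (lag v a)%:~R.
Proof.
move=> ha; have [k hk] := has_angle_unique ha (argP ha).
by rewrite /lag hk addrAC subrr add0r floor_2pi.
Qed.

Lemma lag_uniq v a k : arg v = a + 2 * pi * k%:~R -> lag v a = k.
Proof. by move=> h; rewrite /lag h addrAC subrr add0r floor_2pi. Qed.

Lemma lagD2piZ v a k : has_angle v a -> lag v (a + 2 * pi * k%:~R) = lag v a - k.
Proof.
move=> ha; apply: lag_uniq; rewrite {1}(lagP ha) intrB; ring.
Qed.

(** The number of turns that the choice of [arg] inserts between [v] and [w]: the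
jump of [arg], rounded to an integer.  It is the transport of the universal
cover of the punctured plane. *)
Definition turn v w : int := Num.floor ((arg w - arg v) / (2 * pi) + 2^-1).

(** Angles less than a half turn apart leave a rounding error below 1 / 2.  The
right-hand side is a coboundary, whence the cocycle relation on half planes. *)
Lemma turnE v w a b : has_angle v a -> has_angle w b -> `|a - b| < pi ->
  turn v w = lag w b - lag v a.
Proof.
move=> ha hb; rewrite ltr_norml => /andP[ab ba]; apply: floor_def.
have p0 : 0 < 2 * pi :> R by rewrite mulr_gt0 ?pi_gt0.
rewrite (lagP ha) (lagP hb); set i := lag w b; set j := lag v a.
have -> : (b + 2 * pi * i%:~R - (a + 2 * pi * j%:~R)) / (2 * pi) + 2^-1 =
   (b - a) / (2 * pi) + 2^-1 + (i - j)%:~R :> R.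
  by rewrite intrB; move: (2 * pi) p0 => P P0; field; exact: lt0r_neq0.
have : - 2^-1 < (b - a) / (2 * pi) < 2^-1.
  by rewrite ltr_pdivlMr// ltr_pdivrMr//; lra.
by rewrite intrD1; lra.
Qed.

End Angles.

(** * Zeros of plane maps with a nondegenerate translation part *)

Section Winding.
Variable R : realType.
Implicit Types v w : R * R.

Lemma turn_cocycle_halfplane (S : groupType) (a : int -> S) (phi : R) :
  (forall m n, a (m + n) = (a m * a n)%g) ->
  cocycle_on (fun v w => a (turn v w)) [set v | 0 < dotdir phi v].
Proof.
move=> aD x y z /angle_fromP[h1 l1] /angle_fromP[h2 l2] /angle_fromP[h3 l3].
move: l1 l2 l3; rewrite !ltr_norml => l1 l2 l3.
have -> := turnE h1 h2; last by rewrite ltr_norml; lra.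
have -> := turnE h2 h3; last by rewrite ltr_norml; lra.
have -> := turnE h1 h3; last by rewrite ltr_norml; lra.
by rewrite -aD; congr a; lia.
Qed.

Lemma turn_cocycle (S : groupType) (a : int -> S) v :
  (forall m n, a (m + n) = (a m * a n)%g) -> v != (0, 0) ->
  cocycle_near (fun v w => a (turn v w)) v.
Proof.
move=> aD /has_angle_ex[al hal].
exists [set w | 0 < dotdir al w]; last exact: turn_cocycle_halfplane.
apply: filterS (near_angle hal (divr_gt0 (pi_gt0 R) (ltr0n R 2))) => w [b hb ab].
exact: dotdir_angle hb ab.
Qed.

Lemma quadrant_angle phi v : 0 < dotdir phi v -> 0 < dotdir (phi + pi / 2) v ->
  exists2 al, has_angle v al & phi < al < phi + pi / 2.
Proof.
move=> /angle_fromP[h1 l1] /angle_fromP[h2 l2].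
exists (angle_from phi v) => //.
have E := has_angle_close h1 h2; have p0 := @pi_gt0 R.
move: l1 l2; rewrite !ltr_norml => l1 l2.
have {}E : angle_from phi v = angle_from (phi + pi / 2) v.
  by apply: E; rewrite ltr_norml; lra.
lra.
Qed.

Lemma dotdir0 v : dotdir 0 v = v.1.
Proof. by rewrite /dotdir cos0 sin0; lra. Qed.

Lemma dotdir_pihalf v : dotdir (pi / 2) v = v.2.
Proof. by rewrite /dotdir cos_pihalf sin_pihalf; lra. Qed.

Lemma dotdir_pi v : dotdir pi v = - v.1.
Proof. by rewrite /dotdir cospi sinpi; lra. Qed.

Lemma dotdir_3pihalf v : dotdir (pi + pi / 2) v = - v.2.
Proof. by rewrite /dotdir cosDpihalf sinDpihalf cospi sinpi; lra. Qed.

Lemma dotdir_2pi v : dotdir (pi + pi / 2 + pi / 2) v = v.1.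
Proof. by rewrite /dotdir !(cosDpihalf, sinDpihalf) cospi sinpi; lra. Qed.

(** If [H] had no zero, its direction would have winding number 0 along the boundary
of the square.  But it stays in a half plane on each of the four sides, and these
half planes make one full turn. *)
Lemma square_zero (H : R * R -> R * R) : continuous H ->
  (forall t, 0 <= t <= 1 -> (H (0, t)).1 < 0) ->
  (forall t, 0 <= t <= 1 -> 0 < (H (1, t)).1) ->
  (forall s, 0 <= s <= 1 -> (H (s, 0)).2 < 0) ->
  (forall s, 0 <= s <= 1 -> 0 < (H (s, 1)).2) ->
  exists z, H z = (0, 0).
Proof.
move=> cH Hl Hr Hb Ht; apply: contrapT => Hn0.
have [S [a [b [aD bD _ _ ab]]]] := @noncommuting_rotations 2 2 isT isT.
have a1 : a (- 1) <> 1%g by move=> E; apply: ab; rewrite E mulg1 mul1g.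
have H0 z : H z != (0, 0) by apply/eqP => E; apply: Hn0; exists z.
have rp (g : R -> R * R) : continuous g ->
    regular_path (fun v w => a (turn v w)) (fun t => H (g t)).
  move=> cg; split; first exact: continuous_compfun.
  by move=> t _; apply: turn_cocycle.
have h01 : 0 <= (0 : R) <= 1 by rewrite lexx ler01.
have h11 : 0 <= (1 : R) <= 1 by rewrite lexx ler01.
have mc (g : R -> R * R) phi : continuous g ->
   (forall t, 0 <= t <= 1 -> 0 < dotdir phi (H (g t))) ->
   monodromy (fun v w => a (turn v w)) (fun t => H (g t)) 0 1 =
   a (turn (H (g 0)) (H (g 1))).
  move=> cg gp; have h := monodromy_cocycle (rp g cg) h01 (lexx 1)
    (@turn_cocycle_halfplane S a phi aD).
  exact: h.
have := @monodromy_square R S _ (fun v w => a (turn v w)) H cH.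
rewrite (mc (fun t => (0, t)) pi); [|by prove_continuous|by move=> t /Hl; rewrite dotdir_pi; lra].
rewrite (mc (fun t => (1, t)) 0); [|by prove_continuous|by move=> t /Hr; rewrite dotdir0].
rewrite (mc (fun t => (t, 1)) (pi / 2));
  [|by prove_continuous|by move=> t /Ht; rewrite dotdir_pihalf].
rewrite (mc (fun t => (t, 0)) (pi + pi / 2));
  [|by prove_continuous|by move=> t /Hb; rewrite dotdir_3pihalf; lra].
(* each corner is in the half planes of both adjacent sides *)
have [al11 k11 l11] : exists2 al, has_angle (H (1, 1)) al & 0 < al < 0 + pi / 2.
  by apply: quadrant_angle; rewrite ?add0r ?dotdir0 ?dotdir_pihalf ?Hr ?Ht.
have [al01 k01 l01] : exists2 al, has_angle (H (0, 1)) al & pi / 2 < al < pi / 2 + pi / 2.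
  apply: quadrant_angle; rewrite ?dotdir_pihalf ?Ht// -splitr dotdir_pi.
  by rewrite oppr_gt0 Hl.
have [al00 k00 l00] : exists2 al, has_angle (H (0, 0)) al & pi < al < pi + pi / 2.
  by apply: quadrant_angle; rewrite ?dotdir_pi ?dotdir_3pihalf oppr_gt0 ?Hl ?Hb.
have [al10 k10 l10] : exists2 al, has_angle (H (1, 0)) al &
    pi + pi / 2 < al < pi + pi / 2 + pi / 2.
  apply: quadrant_angle; rewrite ?dotdir_2pi ?Hr// dotdir_3pihalf oppr_gt0.
  exact: Hb.
(* on the side from (1, 0) to (1, 1), the angles start one turn below al10 *)
have k10' := has_angleD2piZ (-1) k10.
have p0 := @pi_gt0 R.
have -> := turnE k00 k01; last by rewrite ltr_norml; lra.
have -> := turnE k01 k11; last by rewrite ltr_norml; lra.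
have -> := turnE k00 k10; last by rewrite ltr_norml; lra.
have -> := turnE k10' k11; last by rewrite intrN ltr_norml; lra.
rewrite (lagD2piZ _ k10) -!aD => E.
have {}E := E (fun s t _ _ => turn_cocycle aD (H0 _)).
move: (lag (H (1, 1)) al11) (lag (H (0, 1)) al01) (lag (H (0, 0)) al00)
  (lag (H (1, 0)) al10) E => i j k l E.
have e1 : j - k + (i - j) = i - k by ring.
have e2 : l - k + (i - (l - -1)) = (i - k) + -1 by ring.
rewrite e1 e2 (aD (i - k)) in E; apply: a1; apply: (mulgI (a (i - k))).
by rewrite -E mulg1.
Qed.

Lemma periodic_int (f : R * R -> R) :
  (forall s t, f (s + 1, t) = f (s, t)) -> (forall s t, f (s, t + 1) = f (s, t)) ->
  forall s t (m n : int), f (s + m%:~R, t + n%:~R) = f (s, t).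
Proof.
move=> f1 f2.
have g1 s t (n : nat) : f (s + n%:R, t) = f (s, t).
  by elim: n => [|n IH]; rewrite ?addr0// -natr1 addrA f1.
have g2 s t (n : nat) : f (s, t + n%:R) = f (s, t).
  by elim: n => [|n IH]; rewrite ?addr0// -natr1 addrA f2.
have h1 s t (m : int) : f (s + m%:~R, t) = f (s, t).
  case: m => n; first exact: g1.
  by rewrite NegzE -(g1 (s + _) t n.+1) intrN addrNK.
have h2 s t (m : int) : f (s, t + m%:~R) = f (s, t).
  case: m => n; first exact: g2.
  by rewrite NegzE -(g2 s (t + _) n.+1) intrN addrNK.
by move=> s t m n; rewrite h1 h2.
Qed.

Lemma periodic_bounded (f : R * R -> R) : continuous f ->
  (forall s t, f (s + 1, t) = f (s, t)) -> (forall s t, f (s, t + 1) = f (s, t)) ->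
  exists M, forall z, `|f z| < M.
Proof.
move=> cf f1 f2.
pose Q : set (R * R) := `[0, 1] `*` `[0, 1].
have cQ : compact (f @` Q).
  apply: continuous_compact; first exact: continuous_subspaceT.
  by apply: compact_setX; exact: segment_compact.
have [M [_ HM]] := compact_bounded cQ.
exists (M + 2) => -[s t].
rewrite -(periodic_int f1 f2 s t (- Num.floor s) (- Num.floor t)).
have fl (x : R) : 0 <= x + (- Num.floor x)%:~R <= 1.
  by have := floor_itv x; rewrite intrN intrD1; lra.
apply: (@le_lt_trans _ _ (M + 1)); last lra.
by apply: (HM (M + 1)); [lra|]; eexists; last reflexivity; split; rewrite /= in_itv /=.
Qed.

(** At bounded distance from the identity, [g] points outwards on the boundary of a
large square. *)
Lemma lattice_zero_std (g : R * R -> R * R) : continuous g ->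
  (forall s t, g (s + 1, t) = ((g (s, t)).1 + 1, (g (s, t)).2)) ->
  (forall s t, g (s, t + 1) = ((g (s, t)).1, (g (s, t)).2 + 1)) ->
  exists z, g z = (0, 0).
Proof.
move=> cg g1 g2.
have [M1 HM1] : exists M, forall z, `|(g z).1 - z.1| < M.
  apply: periodic_bounded; first by prove_continuous.
  - by move=> s t; rewrite g1 /=; lra.
  - by move=> s t; rewrite g2 /=; lra.
have [M2 HM2] : exists M, forall z, `|(g z).2 - z.2| < M.
  apply: periodic_bounded; first by prove_continuous.
  - by move=> s t; rewrite g1 /=; lra.
  - by move=> s t; rewrite g2 /=; lra.
have [N [N1 N2]] : exists N, M1 <= N /\ M2 <= N.
  by exists (Num.max M1 M2); rewrite !le_max !lexx orbT.
pose e (z : R * R) := (N * (2 * z.1 - 1), N * (2 * z.2 - 1)).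
have [|||||z Hz] := @square_zero (fun z => g (e z)).
- by apply: continuous_compfun cg; rewrite /e; prove_continuous.
- by move=> t _; have := HM1 (e (0, t)); rewrite ltr_norml /e /=; lra.
- by move=> t _; have := HM1 (e (1, t)); rewrite ltr_norml /e /=; lra.
- by move=> t _; have := HM2 (e (t, 0)); rewrite ltr_norml /e /=; lra.
- by move=> t _; have := HM2 (e (t, 1)); rewrite ltr_norml /e /=; lra.
by exists (e z).
Qed.

(** The inverse of the matrix of [u] and [w], given by Cramer's rule, reduces the
statement to [lattice_zero_std]. *)
Lemma lattice_zero (f : R * R -> R * R) (u w : R * R) : continuous f ->
  (forall s t, f (s + 1, t) = ((f (s, t)).1 + u.1, (f (s, t)).2 + u.2)) ->
  (forall s t, f (s, t + 1) = ((f (s, t)).1 + w.1, (f (s, t)).2 + w.2)) ->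
  u.1 * w.2 - u.2 * w.1 != 0 ->
  exists z, f z = (0, 0).
Proof.
move=> cf f1 f2; set D := _ - _ => D0.
pose g z := (((f z).1 * w.2 - (f z).2 * w.1) * D^-1, (u.1 * (f z).2 - u.2 * (f z).1) * D^-1).
have [|||z [z1 z2]] := @lattice_zero_std g.
- by rewrite /g; move: D^-1 => Di; prove_continuous.
- move=> s t; rewrite /g f1 /=; congr (_, _); apply: (mulIf D0);
  rewrite ?mulrDl !mulfVK//; rewrite /D; ring.
- move=> s t; rewrite /g f2 /=; congr (_, _); apply: (mulIf D0);
  rewrite ?mulrDl !mulfVK//; rewrite /D; ring.
exists z.
have {}z1 : (f z).1 * w.2 - (f z).2 * w.1 = 0.
  by apply: (mulIf (invr_neq0 D0)); rewrite mul0r.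
have {}z2 : u.1 * (f z).2 - u.2 * (f z).1 = 0.
  by apply: (mulIf (invr_neq0 D0)); rewrite mul0r.
rewrite [LHS]surjective_pairing; congr (_, _); apply: (mulfI D0); rewrite mulr0.
  have -> : D * (f z).1 = u.1 * ((f z).1 * w.2 - (f z).2 * w.1) +
     w.1 * (u.1 * (f z).2 - u.2 * (f z).1) by rewrite /D; ring.
  by rewrite z1 z2 !mulr0 addr0.
have -> : D * (f z).2 = u.2 * ((f z).1 * w.2 - (f z).2 * w.1) +
   w.2 * (u.1 * (f z).2 - u.2 * (f z).1) by rewrite /D; ring.
by rewrite z1 z2 !mulr0 addr0.
Qed.

End Winding.

(** * Lattice-invariant subsets of the plane *)

Section Joined.
Variables (R : realType) (X : topologicalType).
Implicit Types A : set X.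

Definition joined A (x y : X) := exists z : R -> X,
  [/\ continuous z, z 0 = x, z 1 = y & forall t, A (z t)].

Lemma joined_refl A x : A x -> joined A x x.
Proof. by move=> Ax; exists (fun=> x); split => // t; exact: cst_continuous. Qed.

Lemma joined_sym A x y : joined A x y -> joined A y x.
Proof.
move=> [z [cz z0 z1 Az]]; exists (fun t => z (1 - t)); split.
- by apply: (continuous_compfun _ cz); prove_continuous.
- by rewrite subr0.
- by rewrite subrr.
- by move=> t; exact: Az.
Qed.

Lemma joined_trans A x y w : joined A x y -> joined A y w -> joined A x w.
Proof.
move=> [f [cf f0 f1 Af]] [g [cg g0 g1 Ag]].
have cc : continuous (@clamp R) by exact: continuous_clamp.
exists (fun t => if 2 * t - 1 <= 0 then f (clamp (2 * t)) else g (clamp (2 * t - 1))).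
split.
- apply: (@continuous_paste R R X (fun t => 2 * t - 1) (fun t => f (clamp (2 * t)))
    (fun t => g (clamp (2 * t - 1)))); first by prove_continuous.
  + by apply: (continuous_compfun _ cf); apply: (continuous_compfun _ cc); prove_continuous.
  + by apply: (continuous_compfun _ cg); apply: (continuous_compfun _ cc); prove_continuous.
  + by move=> t t0; rewrite t0 clamp0 g0; have -> : 2 * t = 1; [lra|rewrite clamp1].
- by rewrite ifT ?mulr0 ?clamp0//; lra.
- by rewrite ifF ?mulr1; [rewrite (_ : 2 - 1 = 1) ?clamp1//|]; lra.
- by move=> t; case: ifP.
Qed.

End Joined.
Arguments joined R {X}.

Section Lattice.
Variable R : realType.
Implicit Types (z : R * R) (w : int * int) (A : set (R * R)).

Definition translate z w : R * R :=
  (z.1 + 2 * pi * w.1%:~R, z.2 + 2 * pi * w.2%:~R).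

Lemma translate0 z : translate z (0, 0) = z.
Proof. by case: z => a b; rewrite /translate /= mulr0 !addr0. Qed.

Lemma translateD z w w' : translate (translate z w) w' = translate z (w.1 + w'.1, w.2 + w'.2).
Proof. by rewrite /translate /= !intrD; congr (_, _); ring. Qed.

Lemma translateK z w : translate (translate z w) (- w.1, - w.2) = z.
Proof. by rewrite translateD !subrr translate0. Qed.

Lemma continuous_translate w : continuous (fun z => translate z w).
Proof. rewrite /translate; prove_continuous. Qed.

Lemma joined_segment A z z' :
  (forall t : R, 0 <= t <= 1 ->
     A ((1 - t) * z.1 + t * z'.1, (1 - t) * z.2 + t * z'.2)) ->
  joined R A z z'.
Proof.
move=> H; have cc : continuous (@clamp R) by exact: continuous_clamp.
exists (fun t : R => ((1 - clamp t) * z.1 + clamp t * z'.1,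
              (1 - clamp t) * z.2 + clamp t * z'.2)); split.
- by prove_continuous.
- by rewrite clamp0 subr0 !mul1r !mul0r !addr0; case: z {H}.
- by rewrite clamp1 subrr !mul1r !mul0r !add0r; case: z' {H}.
- by move=> t; apply: H; have := clamp_itv t; rewrite /= in_itv.
Qed.

Definition lattice_invariant A := forall z w, A z -> A (translate z w).

Lemma joined_translate A z z' w : lattice_invariant A ->
  joined R A z z' -> joined R A (translate z w) (translate z' w).
Proof.
move=> iA [f [cf f0 f1 Af]]; exists (fun t => translate (f t) w); split.
- exact: (continuous_compfun cf (@continuous_translate w)).
- by rewrite f0.
- by rewrite f1.
- by move=> t; apply: iA.
Qed.

(** The homology classes of the loops in the image of [A] in the torus
R^2 / (2 pi Z)^2. *)
Definition period A w := exists z, joined R A z (translate z w).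

(** Choose a point in each class of components of [A] modulo translation, and let
[D z] be a translation that moves the chosen point into the component of [z].
It is well defined up to periods. *)
Lemma deck_index A : lattice_invariant A ->
  exists D : R * R -> int * int, forall z z' w,
    A z -> joined R A z' (translate z w) ->
    exists2 m, period A m &
      (D z').1 = (D z).1 + w.1 + m.1 /\ (D z').2 = (D z).2 + w.2 + m.2.
Proof.
move=> iA.
pose C z := [set y | exists w, joined R A z (translate y w)].
pose star z := xget (0, 0) (C z).
have Cself z : A z -> C z z by move=> Az; exists (0, 0); rewrite translate0; exact: joined_refl.
have starP z : A z -> C z (star z).
  by move=> Az; rewrite /star; case: xgetP => // /(_ z) /(_ (Cself _ Az)).
pose D z := xget (0, 0) [set w | joined R A z (translate (star z) w)].
have DP z : A z -> joined R A z (translate (star z) (D z)).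
  move=> /starP [w hw]; rewrite /D; case: xgetP => [//|/(_ w)]; exact.
have CE z z' w : joined R A z' (translate z w) -> C z' = C z.
  move=> j; apply/seteqP; split => y [v hv].
    exists (v.1 - w.1, v.2 - w.2).
    have := joined_translate (- w.1, - w.2) iA (joined_trans (joined_sym j) hv).
    by rewrite translateK translateD.
  exists (v.1 + w.1, v.2 + w.2).
  by apply: joined_trans j _; have := joined_translate w iA hv; rewrite translateD.
exists D => z z' w Az j.
have Az' : A z' by case: j => f [_ <- _].
have sE : star z' = star z by rewrite /star (CE _ _ _ j).
have j1 := DP _ Az; have j2 := DP _ Az'; rewrite sE in j2.
exists ((D z').1 - ((D z).1 + w.1), (D z').2 - ((D z).2 + w.2)) => /=; last first.
  by split; ring.
exists (translate (star z) ((D z).1 + w.1, (D z).2 + w.2)).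
rewrite translateD /=; have E (k l : int) : k + (l - k) = l by ring.
rewrite !E -surjective_pairing.
apply: joined_trans j2; apply: joined_trans (joined_sym j).
by apply: joined_sym; have := joined_translate w iA j1; rewrite translateD.
Qed.

Lemma open_box A z : open A -> A z -> exists2 e : R, 0 < e &
  forall z', `|z'.1 - z.1| < e -> `|z'.2 - z.2| < e -> A z'.
Proof.
move=> oA Az; have /nbhs_ballP[e /= e0 He] : nbhs z A by exact: open_nbhs_nbhs.
by exists e => // z' h1 h2; apply: He; split; rewrite /ball /= distrC.
Qed.

Lemma convex_lt (a b m t : R) : a < m -> b < m -> 0 <= t <= 1 ->
  (1 - t) * a + t * b < m.
Proof.
move=> am bm /andP[t0 t1]; apply: (@le_lt_trans _ _ (Num.max a b)).
  have h1 : a <= Num.max a b by rewrite le_max lexx.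
  have h2 : b <= Num.max a b by rewrite le_max lexx orbT.
  by nra.
by rewrite gt_max am.
Qed.

Lemma joined_box A z e z1 z2 :
  (forall z', `|z'.1 - z.1| < e -> `|z'.2 - z.2| < e -> A z') ->
  `|z1.1 - z.1| < e -> `|z1.2 - z.2| < e ->
  `|z2.1 - z.1| < e -> `|z2.2 - z.2| < e -> joined R A z1 z2.
Proof.
move=> HA; rewrite !ltr_norml => h1 h2 h3 h4; apply: joined_segment => t t01.
have H (a b c : R) : - e < a - c < e -> - e < b - c < e ->
    `|(1 - t) * a + t * b - c| < e.
  move=> /andP[a1 a2] /andP[b1 b2]; rewrite ltr_norml.
  have ha : - a < e - c by lra.
  have hb : - b < e - c by lra.
  have ha' : a < e + c by lra.
  have hb' : b < e + c by lra.
  by have := convex_lt ha hb t01; have := convex_lt ha' hb' t01; lra.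
by apply: HA; apply: H.
Qed.

(** Repeat the path, translated by the integral part of the time. *)
Lemma equivariant_extension (f : R -> R * R) w : continuous f ->
  f 1 = translate (f 0) w ->
  exists ext : R -> R * R, [/\ continuous ext,
    forall t, ext (t + 1) = translate (ext t) w &
    forall t, exists s m, ext t = translate (f s) m].
Proof.
move=> cf f1.
pose mulw (n : int) := (w.1 * n, w.2 * n).
pose G t := f (clamp t).
have cG : continuous G by apply: continuous_compfun cf; exact: continuous_clamp.
pose ext t := translate (G (t - (Num.floor t)%:~R)) (mulw (Num.floor t)).
have cext : continuous ext.
  move=> t0; pose n := Num.floor t0.
  (* a continuous formula for ext on both sides of the integer n *)
  pose E t := if t - n%:~R <= 0 then translate (G (t - n%:~R + 1)) (mulw (n - 1))
              else translate (G (t - n%:~R)) (mulw n).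
  have cE : continuous E.
    apply: (@continuous_paste R R _ (fun t => t - n%:~R)
      (fun t => translate (G (t - n%:~R + 1)) (mulw (n - 1)))
      (fun t => translate (G (t - n%:~R)) (mulw n))); first by prove_continuous.
    - apply: (continuous_compfun (g := fun z => translate z _) _ (@continuous_translate _)).
      by apply: (continuous_compfun (g := G) _ cG); prove_continuous.
    - apply: (continuous_compfun (g := fun z => translate z _) _ (@continuous_translate _)).
      by apply: (continuous_compfun (g := G) _ cG); prove_continuous.
    - move=> t ->; rewrite add0r /G clamp1 clamp0 f1 translateD /mulw /=.
      by congr translate; congr (_, _); ring.
  have n0 := floor_itv t0; rewrite -/n in n0.
  have eqE t : n%:~R - 1 < t < n%:~R + 1 -> ext t = E t.
    move=> tn; rewrite /ext /E; have [tn0|tn0|tn0] := ltgtP t n%:~R.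
    - rewrite ifT; last lra.
      have -> : Num.floor t = n - 1 by apply: floor_def; rewrite subrK intrB; lra.
      by have -> : t - (n - 1)%:~R = t - n%:~R + 1 by rewrite intrB; lra.
    - rewrite ifF; last lra.
      by have -> : Num.floor t = n by apply: floor_def; rewrite intrD1; lra.
    - have -> : Num.floor t = n by apply: floor_def; rewrite intrD1; lra.
      rewrite tn0 subrr lexx add0r /G clamp1 clamp0 f1 translateD /mulw /=.
      by congr translate; congr (_, _); ring.
  have e0 : ext t0 = E t0 by apply: eqE; move: n0; rewrite intrD1; lra.
  rewrite /continuous_at e0; apply: cvg_trans (cE t0).
  apply: near_eq_cvg; near=> t; apply/esym/eqE; apply/andP; split; near: t.
    by apply: lt_nbhsr; move: n0; rewrite intrD1; lra.
  by apply: lt_nbhsl; move: n0; rewrite intrD1; lra.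
have ext1 t : ext (t + 1) = translate (ext t) w.
  rewrite /ext floorDrz ?rpred1// floor1 intrD1 translateD /mulw /=.
  have -> : t + 1 - ((Num.floor t)%:~R + 1) = t - (Num.floor t)%:~R by ring.
  by congr translate; congr (_, _); ring.
exists ext; split => // t.
by exists (clamp (t - (Num.floor t)%:~R)), (mulw (Num.floor t)).
Unshelve. all: by end_near. Qed.

(** Where the lifts meet, their difference vanishes; [lattice_zero] provides such a
pair of parameters. *)
Lemma curves_meet (x y : R -> R) (u : R * R) (f : R -> R * R) (w : int * int) :
  continuous x -> continuous y -> continuous f ->
  (forall t, x (t + 1) = x t + u.1) -> (forall t, y (t + 1) = y t + u.2) ->
  f 1 = translate (f 0) w ->
  u.1 * w.2%:~R - u.2 * w.1%:~R != 0 ->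
  exists s t m, (x s, y s) = translate (f t) m.
Proof.
move=> cx cy cf xp yp f1 D0.
have [ext [cext ext1 extE]] := equivariant_extension cf f1.
have [||||[s t]] := @lattice_zero R (fun z => (x z.1 - (ext z.2).1, y z.1 - (ext z.2).2))
  u (- (2 * pi * w.1%:~R), - (2 * pi * w.2%:~R)).
- have ce : continuous (fun z : R * R => ext z.2).
    by apply: (continuous_compfun _ cext); prove_continuous.
  have cx1 : continuous (fun z : R * R => x z.1).
    by apply: (continuous_compfun _ cx); prove_continuous.
  have cy1 : continuous (fun z : R * R => y z.1).
    by apply: (continuous_compfun _ cy); prove_continuous.
  exact: (continuous_pairfun (continuous_addfun cx1 (continuous_oppfun (continuous_fstfun ce)))
                             (continuous_addfun cy1 (continuous_oppfun (continuous_sndfun ce)))).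
- by move=> s t /=; rewrite xp yp; congr (_, _); ring.
- by move=> s t /=; rewrite ext1 /=; congr (_, _); ring.
- have -> : u.1 * - (2 * pi * w.2%:~R) - u.2 * - (2 * pi * w.1%:~R) =
    - (2 * pi * (u.1 * w.2%:~R - u.2 * w.1%:~R)) by ring.
  by rewrite oppr_eq0 mulf_neq0// mulf_neq0// lt0r_neq0// pi_gt0.
move=> [] /= h1 h2; have [t' [m E]] := extE t.
exists s, t', m; rewrite -E [RHS]surjective_pairing.
by congr (_, _); apply/eqP; rewrite -subr_eq0; apply/eqP.
Qed.

End Lattice.

(** * Coordinates around the standard torus *)

Section Tube.
Variable R : realType.
Implicit Types (v : 'rV[R]_3) (r x y : R).

(** The point at distance [r] from the core circle of the solid torus, at longitude
[x] and meridional angle [y].  The radius may exceed 1, and reaches the axis at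
[r = 2] and [y = pi]. *)
Definition tube r x y : 'rV[R]_3 :=
  \row_(i < 3) nth 0 [:: (2 + r * cos y) * cos x; (2 + r * cos y) * sin x; r * sin y] i.

Lemma tube1 x y : tube 1 x y = torus_point x y.
Proof. by rewrite /tube !mul1r. Qed.

Lemma tube_translate r (z : R * R) w : tube r (translate z w).1 (translate z w).2 = tube r z.1 z.2.
Proof.
have [c1 s1] := sincosD2piZ z.1 w.1; have [c2 s2] := sincosD2piZ z.2 w.2.
by rewrite /tube [in LHS]c1 [in LHS]c2 [in LHS]s1 [in LHS]s2.
Qed.

Lemma continuous_row3 (U : topologicalType) (f0 f1 f2 : U -> R) :
  continuous f0 -> continuous f1 -> continuous f2 ->
  continuous (fun u => (\row_(i < 3) nth 0 [:: f0 u; f1 u; f2 u] i : 'rV[R]_3)).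
Proof.
move=> c0 c1 c2 u B [P nP sPB].
suff H (j : 'I_3) : \forall w \near u, P 0 j (nth 0 [:: f0 w; f1 w; f2 w] j).
  have : \forall w \near u, forall j : 'I_3, P 0 j (nth 0 [:: f0 w; f1 w; f2 w] j).
    exact: filter_forall.
  rewrite near_simpl; apply: filterS => w Hw; apply: sPB => i j.
  by rewrite ord1 mxE; exact: Hw.
have := nP 0 j; rewrite mxE.
by case: j => [[|[|[|]]]] //= ?; [exact: c0|exact: c1|exact: c2].
Qed.

Lemma continuous_tube (U : topologicalType) (r x y : U -> R) :
  continuous r -> continuous x -> continuous y ->
  continuous (fun u => tube (r u) (x u) (y u)).
Proof. by move=> cr cx cy; apply: continuous_row3; prove_continuous. Qed.

(** Its angle is the longitude.  It vanishes only on the axis. *)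
Definition horizontal v : R * R := (v 0 0, v 0 1).
(** The vector from the core to [v] in the half plane bounded by the axis: its angle
is the meridional angle, and its length the radius in [tube]. *)
Definition meridional v : R * R :=
  (Num.sqrt (v 0 0 ^+ 2 + v 0 1 ^+ 2) - 2, v 0 2%:R).

Lemma continuous_horizontal : continuous horizontal.
Proof.
by apply: continuous_pairfun; exact: coord_continuous.
Qed.

Lemma continuous_meridional : continuous meridional.
Proof.
apply: continuous_pairfun; last exact: coord_continuous.
apply: continuous_addfun; last by prove_continuous.
apply: (continuous_compfun (g := @Num.sqrt R)); last exact: sqrt_continuous.
by apply: continuous_addfun; apply: continuous_mulfun; exact: coord_continuous.
Qed.

Lemma horizontal_tube r x y :
  horizontal (tube r x y) = ((2 + r * cos y) * cos x, (2 + r * cos y) * sin x).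
Proof. by rewrite /horizontal !mxE. Qed.

Lemma meridional_tube r x y : 0 <= 2 + r * cos y ->
  meridional (tube r x y) = (r * cos y, r * sin y).
Proof.
move=> p0; rewrite /meridional !mxE /= !exprMn -mulrDr cos2Dsin2 mulr1.
by rewrite sqrtr_sqr ger0_norm// (addrC 2) addrK.
Qed.

Lemma tube_gt0 r x : 0 <= r < 2 -> 0 < 2 + r * cos x.
Proof. by move=> r0; have := cos_geN1 x; nra. Qed.

Lemma tube_ge0 r x : 0 <= r <= 2 -> 0 <= 2 + r * cos x.
Proof. by move=> r0; have := cos_geN1 x; nra. Qed.

Lemma horizontal_angle r x y : 0 < 2 + r * cos y ->
  has_angle (horizontal (tube r x y)) x.
Proof. by move=> h; exists (2 + r * cos y) => //; rewrite horizontal_tube. Qed.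

Lemma meridional_angle r x y : 0 < r -> 0 <= 2 + r * cos y ->
  has_angle (meridional (tube r x y)) y.
Proof. by move=> r0 h; exists r => //; rewrite meridional_tube. Qed.

Lemma torus_point_inj x y x' y' : torus_point x y = torus_point x' y' ->
  exists w, (x', y') = translate (x, y) w.
Proof.
rewrite -!tube1 => E.
have p z : 0 < 2 + 1 * cos z :> R by apply: tube_gt0; rewrite ler01; lra.
have h := horizontal_angle x (p y); have h' := horizontal_angle x' (p y').
have m := meridional_angle x ltr01 (ltW (p y)).
have m' := meridional_angle x' ltr01 (ltW (p y')).
rewrite -E in h' m'.
have [k ->] := has_angle_unique h h'; have [l ->] := has_angle_unique m m'.
by exists (k, l).
Qed.

(** Polar coordinates of [horizontal v], then of [meridional v]. *)
Lemma tube_surj v : exists r x y, [/\ v = tube r x y, 0 <= r & 0 <= 2 + r * cos y].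
Proof.
have polar (u : R * R) : exists2 r, 0 <= r & exists a, u = (r * cos a, r * sin a).
  have [->|u0] := eqVneq u (0, 0); first by exists 0 => //; exists 0; rewrite !mul0r.
  by have [a [r r0 E]] := has_angle_ex u0; exists r; [exact: ltW|exists a].
have [rho rho0 [x Ex]] := polar (horizontal v).
have [r r0 [y Ey]] := polar (meridional v).
move: Ex Ey; rewrite /horizontal /meridional => -[e0 e1].
rewrite e0 e1 !exprMn -mulrDr cos2Dsin2 mulr1 sqrtr_sqr ger0_norm// => -[e2 e3].
have rE : 2 + r * cos y = rho by rewrite -e2; lra.
exists r, x, y; split; rewrite ?rE//.
apply/rowP => i; rewrite mxE rE.
by case: i => [[|[|[|]]]] //= ?; rewrite -?e0 -?e1 -?e3; congr (v _ _); apply: val_inj.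
Qed.

End Tube.

(** * Closed curves on the torus *)

Section TorusCurve.
Variables (R : realType) (p q : int) (K : set 'rV[R]_3).
Variables (c : R -> 'rV[R]_3) (x y : R -> R).
Hypothesis c_cont : continuous c.
Hypothesis c_inj : forall s t, c s = c t -> exists n : int, t = s + n%:~R.
Hypothesis c_range : range c = K.
Hypotheses (x_cont : continuous x) (y_cont : continuous y).
Hypothesis cE : forall t, c t = torus_point (x t) (y t).
Hypothesis x_per : forall t, x (t + 1) = x t + 2 * pi * p%:~R.
Hypothesis y_per : forall t, y (t + 1) = y t + 2 * pi * q%:~R.

Lemma equivariant_int (f : R -> R) (a : R) : (forall t, f (t + 1) = f t + a) ->
  forall t (n : int), f (t + n%:~R) = f t + a * n%:~R.
Proof.
move=> fa.
have H t (n : nat) : f (t + n%:R) = f t + a * n%:R.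
  elim: n => [|n IH]; first by rewrite mulr0 !addr0.
  by rewrite -natr1 addrA fa IH mulrDr mulr1 addrA.
move=> t [n|n]; first exact: H.
have := H (t + (Negz n)%:~R) n.+1.
rewrite NegzE intrN addrNK => ->; rewrite mulrN -!pmulrn; lra.
Qed.

Lemma c_per_int t (n : int) : c (t + n%:~R) = c t.
Proof.
rewrite !cE (equivariant_int x_per) (equivariant_int y_per) -!tube1.
have := tube_translate 1 (x t, y t) (p * n, q * n); rewrite /translate /= !intrM.
by rewrite !mulrA.
Qed.

Lemma c_rep t0 v : K v -> exists2 t, t0 - 2^-1 <= t <= t0 + 2^-1 & v = c t.
Proof.
rewrite -c_range => -[s _ <-].
exists (s + (- Num.floor (s - t0 + 2^-1))%:~R); last by rewrite c_per_int.
by have := floor_itv (s - t0 + 2^-1); rewrite intrN intrD1; lra.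
Qed.

Lemma compact_image (A : set R) : compact A -> compact (c @` A).
Proof. by move=> cA; apply: continuous_compact => //; exact: continuous_subspaceT. Qed.

Lemma closed_image (A : set R) : compact A -> closed (c @` A).
Proof.
move=> cA; apply: compact_closed; last exact: compact_image.
exact: norm_hausdorff.
Qed.

Lemma closedK : closed K.
Proof.
have -> : K = c @` `[0 - 2^-1, 0 + 2^-1].
  apply/seteqP; split => v.
    by move=> /(c_rep 0)[t t0 ->]; exists t => //=; rewrite in_itv.
  by move=> [t _ <-]; rewrite -c_range; exists t.
by apply: closed_image; exact: segment_compact.
Qed.

(** The part of the universal cover of the torus that lies over the complement of
[K]. *)
Definition off_lift : set (R * R) := [set z | ~ K (torus_point z.1 z.2)].

Lemma continuous_torus_point : continuous (fun z : R * R => torus_point z.1 z.2).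
Proof.
have -> : (fun z : R * R => torus_point z.1 z.2) = (fun z => tube 1 z.1 z.2).
  by apply/funext => z; rewrite tube1.
by apply: continuous_tube; prove_continuous.
Qed.

Lemma open_off_lift : open off_lift.
Proof.
rewrite openE => z fz.
have : nbhs (torus_point z.1 z.2) (~` K).
  by apply: open_nbhs_nbhs; split => //; rewrite openC; exact: closedK.
by move=> /(continuous_torus_point).
Qed.

Lemma off_lift_translate : lattice_invariant off_lift.
Proof. by move=> z w; rewrite /off_lift /= -!tube1 tube_translate. Qed.

Lemma not_off_liftP z : ~ off_lift z -> exists t w, z = translate (x t, y t) w.
Proof.
move=> /contrapT; rewrite -c_range => -[t _]; rewrite cE => /torus_point_inj[w E].
by exists t, w; rewrite -E; case: z {E}.
Qed.

Lemma curve_not_off_lift t w : ~ off_lift (translate (x t, y t) w).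
Proof.
by apply; rewrite -tube1 tube_translate tube1 /= -cE -c_range; exists t.
Qed.

(** A loop off the curve does not meet it, so by [curves_meet] its class is
proportional to (p, q); as p and q are coprime it is an integral multiple. *)
Lemma period_multiple w : coprimez p q -> p != 0 ->
  period off_lift w -> exists k, w = (p * k, q * k).
Proof.
move=> cpq p0 [z [f [cf f0 f1 ff]]].
have E : p * w.2 - q * w.1 = 0.
  apply/eqP; apply: contrapT => /negP D0.
  have [||s [t [m st]]] := @curves_meet R x y (2 * pi * p%:~R, 2 * pi * q%:~R) f w
    x_cont y_cont cf x_per y_per.
  - by rewrite f0 f1.
  - rewrite /= -!mulrA -!mulrBr -!intrM -intrB !mulf_eq0 intr_eq0.
    by rewrite !negb_or pnatr_eq0 lt0r_neq0 ?pi_gt0.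
  have : ~ off_lift (translate (x s, y s) (0, 0)) by exact: curve_not_off_lift.
  by rewrite translate0 st; apply; apply: off_lift_translate.
have dv : (p %| w.1)%Z.
  rewrite -(Gauss_dvdzr _ cpq); apply/dvdzP; exists w.2.
  by rewrite (mulrC w.2); apply/esym/eqP; rewrite -subr_eq0 E.
have [k Ek] := dvdzP dv; exists k.
rewrite [LHS]surjective_pairing Ek (mulrC k); congr (_, _).
by apply: (mulfI p0); move/eqP: E; rewrite subr_eq0 => /eqP ->; rewrite Ek; ring.
Qed.

(** The form (q x - p y) / (2 pi) vanishes on the class (p, q), so it is 1-periodic
along the lift of the curve; [drift] is its opposite. *)
Let drift t : R := - (q%:~R * x t - p%:~R * y t) / (2 * pi).

Lemma drift_cont : continuous drift.
Proof. by rewrite /drift; prove_continuous. Qed.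

Lemma drift_per t (n : int) : drift (t + n%:~R) = drift t.
Proof.
rewrite /drift (equivariant_int x_per) (equivariant_int y_per); congr (- _ / _); ring.
Qed.

(** As a function on [K], [drift] is continuous because [c] induces a homeomorphism
from the circle onto [K]; Tietze's theorem extends it. *)
Lemma extension_from_curve : exists2 e : 'rV[R]_3 -> R, continuous e &
  forall t, e (c t) = drift t.
Proof.
pose f v := drift (xget 0 [set t | c t = v]).
have f_drift t : f (c t) = drift t.
  rewrite /f; case: xgetP => [t' _ /= h|/(_ t) []//].
  by have [n ->] := c_inj h; rewrite drift_per.
have [M HM] : exists M, forall z : R * R, `|drift z.1| < M.
  apply: (@periodic_bounded R (fun z => drift z.1)); last by [].
    by apply: (continuous_compfun _ drift_cont); prove_continuous.
  by move=> s0 t0; exact: (drift_per s0 1).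
have M0 : 0 < M by apply: le_lt_trans (HM (0, 0)).
have fM v : K v -> `|f v| <= M by move=> _; rewrite /f; apply: ltW; apply: (HM (_, 0)).
have cf : {within K, continuous f}.
  apply/subspace_continuousP => v Kv; have [t0 _ vE] := c_rep 0 Kv; subst v.
  apply/cvgrPdist_lt => eps eps0; rewrite near_withinE /from_subspace f_drift.
  (* a compact set of parameters, whose image is away from c t0 *)
  pose F : set R := `[t0 - 2^-1, t0 + 2^-1] `&` [set t | eps <= `|drift t - drift t0|].
  have cF : compact F.
    apply: compact_closedI; first exact: segment_compact.
    have cn : continuous (fun t : R => `|drift t - drift t0|).
      apply: continuous_normfun.
      exact: (continuous_addfun (@drift_cont) (continuous_constfun (- drift t0))).
    apply: (@closed_comp _ _ _ [set r | eps <= r]); last exact: closed_ge.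
    by move=> t _; exact: cn.
  have : nbhs (c t0) (~` (c @` F)).
    apply: open_nbhs_nbhs; split; first by rewrite openC; exact: closed_image.
    move=> [t [_ /= te] /esym/c_inj[n tn]]; move: te; rewrite tn drift_per subrr normr0.
    by rewrite leNgt eps0.
  apply: filterS => v nv Kv'; have [t tt vE] := c_rep t0 Kv'.
  rewrite vE f_drift distrC ltNge; apply/negP => te; apply: nv; rewrite vE.
  by exists t; split; rewrite //= in_itv.
have [g [fg cg _]] :=
  @continuous_bounded_extension _ R (@pseudometric_normal R _) K closedK f M M0 cf fM.
by exists g => // t; rewrite -f_drift fg// inE -c_range; exists t.
Qed.

(** If 0 were the only period, the index [D] of [deck_index] would be a well defined
integral vector, locally constant off the curve.  Let F be (q x - p y) / (2 pi)
plus the extension of [drift], which is integral on the curve, and let G be the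
second component of [D] where F is a half integer, moving to y / (2 pi) near the
curve.  The translation part of (F, G) is invertible, so (F, G) takes
the value (1/2, 1/2) by [lattice_zero]; but G is an integer where F = 1/2. *)
Lemma essential_period : q != 0 -> exists2 w, period off_lift w & w <> (0, 0).
Proof.
move=> q0; apply: contrapT => nper.
have per0 w : period off_lift w -> w = (0, 0).
  by move=> pw; apply: contrapT => w0; apply: nper; exists w.
have [D DP] := deck_index off_lift_translate.
have Dj z z' w : off_lift z -> joined R off_lift z' (translate z w) -> (D z').2 = (D z).2 + w.2.
  by move=> fz j; have [m /per0 -> [_ /= ->]] := DP _ _ _ fz j; rewrite addr0.
have [e ce eE] := extension_from_curve.
have pi2 : 2 * pi != 0 :> R by rewrite mulf_neq0// lt0r_neq0// pi_gt0.
pose F (z : R * R) := (q%:~R * z.1 - p%:~R * z.2) / (2 * pi) + e (torus_point z.1 z.2).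
have cF : continuous F.
  apply: continuous_addfun; first by prove_continuous.
  exact: (continuous_compfun continuous_torus_point ce).
have FT z w : F (translate z w) = F z + (q * w.1 - p * w.2)%:~R.
  rewrite /F -!tube1 tube_translate /translate /= intrB !intrM.
  move: (2 * pi) pi2 => P P0; field; exact: P0.
have FK z : ~ off_lift z -> exists n : int, F z = n%:~R.
  move=> /not_off_liftP[t [w ->]]; rewrite FT.
  suff -> : F (x t, y t) = 0 by rewrite add0r; exists (q * w.1 - p * w.2).
  by rewrite /F /= -cE eE /drift mulNr subrr.
(* l is 0 near the curve and 1 where F is a half integer *)
pose l z := clamp (- cos (2 * pi * F z)).
have cl : continuous l.
  by apply: continuous_compfun (@continuous_clamp R); prove_continuous.
have lT z w : l (translate z w) = l z by rewrite /l FT mulrDr cosD2piZ.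
have l0 z : 0 < cos (2 * pi * F z) -> l z = 0.
  move=> h; rewrite /l /clamp (min_idPr _); last by lra.
  by rewrite (max_idPl _)//; lra.
have cosK z : ~ off_lift z -> cos (2 * pi * F z) = 1.
  by move=> /FK[n ->]; rewrite -[2 * pi * _]add0r cosD2piZ cos0.
pose G z := l z * (D z).2%:~R + (1 - l z) * (z.2 / (2 * pi)).
have cG : continuous G.
  move=> z; have [fz|nfz] := pselect (off_lift z).
    pose G' z' := l z' * (D z).2%:~R + (1 - l z') * (z'.2 / (2 * pi)).
    have cG' : continuous G' by rewrite /G'; prove_continuous.
    have [r r0 Hr] := open_box open_off_lift fz.
    rewrite /continuous_at -/(G' z); apply: cvg_trans (cG' z).
    apply: near_eq_cvg; apply: filterS (nbhsx_ballx z _ r0) => z' [/= b1 b2].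
    rewrite /ball /= distrC in b1; rewrite /ball /= distrC in b2.
    rewrite /G /G' (_ : (D z').2 = (D z).2)//.
    rewrite (Dj z z' (0, 0)) ?addr0// translate0.
    by apply: (joined_box Hr) => //; rewrite subrr normr0.
  have G0 : G z = z.2 / (2 * pi).
    by rewrite /G l0 ?cosK// mul0r add0r subr0 mul1r.
  have c1 : continuous (fun z' : R * R => z'.2 / (2 * pi)) by prove_continuous.
  rewrite /continuous_at G0; apply: cvg_trans (c1 z).
  apply: near_eq_cvg.
  have : \forall z' \near z, 0 < cos (2 * pi * F z').
    have cc : continuous (fun z' => cos (2 * pi * F z')) by prove_continuous.
    by apply: (cvgr_gt _ (cc z)); rewrite cosK.
  by apply: filterS => z' h; rewrite /G l0// mul0r add0r subr0 mul1r.
have GT z w : G (translate z w) = G z + w.2%:~R.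
  rewrite /G lT; have [fz|nfz] := pselect (off_lift z).
    rewrite (Dj z _ w)//; last exact/joined_refl/off_lift_translate.
    rewrite intrD /=; move: (2 * pi) pi2 => P P0; field; exact: P0.
  rewrite l0 ?cosK// /=; move: (2 * pi) pi2 => P P0; field; exact: P0.
pose h (z : R * R) := (2 * pi * z.1, 2 * pi * z.2).
have h1 s t : h (s + 1, t) = translate (h (s, t)) (1, 0).
  by rewrite /h /translate /=; congr (_, _); ring.
have h2 s t : h (s, t + 1) = translate (h (s, t)) (0, 1).
  by rewrite /h /translate /=; congr (_, _); ring.
have ch : continuous h by rewrite /h; prove_continuous.
have cFh := continuous_compfun ch cF; have cGh := continuous_compfun ch cG.
have [||||z [Fz Gz]] := @lattice_zero R (fun z => (F (h z) - 2^-1, G (h z) - 2^-1))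
  (q%:~R, 0) (- p%:~R, 1).
- exact: continuous_pairfun (continuous_addfun cFh (continuous_constfun _))
    (continuous_addfun cGh (continuous_constfun _)).
- by move=> s t; rewrite h1 FT GT /=; congr (_, _); rewrite ?intrB ?intrM; ring.
- by move=> s t; rewrite h2 FT GT /=; congr (_, _); rewrite ?intrB ?intrM; ring.
- by rewrite /= mulr1 mul0r subr0 intr_eq0.
have F2 : F (h z) = 2^-1 by lra.
have cm1 : cos (2 * pi * F (h z)) = - 1.
  by rewrite F2 mulrAC mulfV ?mul1r ?cospi.
have lz1 : l (h z) = 1 by rewrite /l cm1 opprK clamp1.
have : (2 * (D (h z)).2)%:~R = 1%:~R :> R.
  by move: Gz; rewrite /G lz1 mul1r subrr mul0r addr0 intrM => Gz; lra.
by move=> /intr_inj; lia.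
Qed.

End TorusCurve.

(** * A covering of the complement *)

Section TorusCocycle.
Variables (R : realType) (p q : int) (K : set 'rV[R]_3).
Hypothesis open_off_lift : open (off_lift K).
Hypothesis off_lift_translate : lattice_invariant (off_lift K).
Hypothesis period_mult : forall w, period (off_lift K) w -> exists k, w = (p * k, q * k).
Variable D : R * R -> int * int.
Hypothesis DP : forall z z' w, off_lift K z -> joined R (off_lift K) z' (translate z w) ->
  exists2 m, period (off_lift K) m &
    (D z').1 = (D z).1 + w.1 + m.1 /\ (D z').2 = (D z).2 + w.2 + m.2.
Variables (S : groupType) (a b : int -> S).
Hypothesis aD : forall m n, a (m + n) = (a m * a n)%g.
Hypothesis bD : forall m n, b (m + n) = (b m * b n)%g.
Hypotheses (ap : forall k, a (p * k) = 1%g) (bq : forall k, b (q * k) = 1%g).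
Implicit Types v w : 'rV[R]_3.

Definition inside v := (meridional v).1 ^+ 2 + (meridional v).2 ^+ 2 <= 1.

Definition angles v : R * R := (arg (horizontal v), arg (meridional v)).

(** The trivialization, over the torus minus [K], of the covering of monodromy [a]
inside and of the covering of monodromy [b] outside. *)
Definition sheet v : S := if inside v then a (D (angles v)).1 else b (D (angles v)).2.

(** Over the solid torus the covering has monodromy [a] along longitudes, and over
its exterior monodromy [b] along meridians.  The two are glued over the torus
minus [K], where [sheet] trivializes both of them. *)
Definition torus_cocycle v w : S :=
  if inside v && inside w then a (turn (horizontal v) (horizontal w))
  else if ~~ inside v && ~~ inside w then b (turn (meridional v) (meridional w))
  else ((sheet v)^-1 * sheet w)%g.

Local Notation tau := torus_cocycle.

Lemma inside_tube r x y : 0 <= r -> 0 <= 2 + r * cos y ->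
  inside (tube r x y) = (r <= 1).
Proof.
move=> r0 h; rewrite /inside meridional_tube//= !exprMn -mulrDr cos2Dsin2 mulr1.
by rewrite expr_le1.
Qed.

(** Passing from [z] to the chosen angles of [v] changes [D] by the number of turns
between them and by a multiple of (p, q), on which [a] and [b] are trivial. *)
Lemma deck_lag v al be z u : has_angle (horizontal v) al ->
  has_angle (meridional v) be -> off_lift K z ->
  joined R (off_lift K) (al, be) (translate z u) ->
  a (D (angles v)).1 = a ((D z).1 + u.1 + lag (horizontal v) al) /\
  b (D (angles v)).2 = b ((D z).2 + u.2 + lag (meridional v) be).
Proof.
move=> ha hb fz j.
pose l := (lag (horizontal v) al, lag (meridional v) be).
have j' : joined R (off_lift K) (angles v) (translate z (u.1 + l.1, u.2 + l.2)).
  rewrite -translateD /angles (lagP ha) (lagP hb).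
  exact: (joined_translate l off_lift_translate j).
have [m /period_mult[k ->] /= [-> ->]] := DP fz j'.
by split; rewrite addrA ?(aD _ (p * k)) ?(bD _ (q * k)) ?ap ?bq mulg1.
Qed.

(** Near a point of the torus that is off [K], the transport is the coboundary of
[sheet] on both sides of the torus. *)
Lemma cocycle_sheet z e : off_lift K z -> e <= 1 ->
  (forall z', `|z'.1 - z.1| < e -> `|z'.2 - z.2| < e -> off_lift K z') ->
  cocycle_on tau [set v |
     (exists2 al, has_angle (horizontal v) al & `|al - z.1| < e) /\
     (exists2 be, has_angle (meridional v) be & `|be - z.2| < e)].
Proof.
move=> fz e1 box.
have tauE v w : (exists2 al, has_angle (horizontal v) al & `|al - z.1| < e) /\
     (exists2 be, has_angle (meridional v) be & `|be - z.2| < e) ->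
     (exists2 al, has_angle (horizontal w) al & `|al - z.1| < e) /\
     (exists2 be, has_angle (meridional w) be & `|be - z.2| < e) ->
     tau v w = ((sheet v)^-1 * sheet w)%g.
  move=> [[al hal al1] [be hbe be1]] [[al' hal' al1'] [be' hbe' be1']].
  have e0 : 0 < e by apply: le_lt_trans al1; exact: normr_ge0.
  have j x y : `|x - z.1| < e -> `|y - z.2| < e ->
      joined R (off_lift K) (x, y) (translate z (0, 0)).
    by move=> hx hy; rewrite translate0; apply: (joined_box box) => //=;
       rewrite subrr normr0.
  have [d1 d2] := deck_lag hal hbe fz (j _ _ al1 be1).
  have [d1' d2'] := deck_lag hal' hbe' fz (j _ _ al1' be1').
  have p2 := @pi_ge2 R.
  rewrite /tau /sheet; case: (inside v); case: (inside w) => //=.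
  - rewrite d1 d1' (turnE hal hal'); last first.
      by move: al1 al1'; rewrite !ltr_norml; lra.
    by rewrite -(int_homN aD) -aD; congr a; ring.
  - rewrite d2 d2' (turnE hbe hbe'); last first.
      by move: be1 be1'; rewrite !ltr_norml; lra.
    by rewrite -(int_homN bD) -bD; congr b; ring.
by move=> x y w hx hy hw; rewrite !tauE// mulgA mulgK.
Qed.

Lemma cocycle_inside phi :
  cocycle_on tau [set v | inside v /\ 0 < dotdir phi (horizontal v)].
Proof.
move=> x y w [ix hx] [iy hy] [iw hw]; rewrite /tau ix iy iw /=.
exact: (@turn_cocycle_halfplane R S a phi aD (horizontal x) (horizontal y) (horizontal w)).
Qed.

Lemma cocycle_outside phi :
  cocycle_on tau [set v | ~~ inside v /\ 0 < dotdir phi (meridional v)].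
Proof.
move=> x y w [ix hx] [iy hy] [iw hw]; rewrite /tau ix iy iw (negbTE ix) (negbTE iy) /=.
exact: (@turn_cocycle_halfplane R S b phi bD (meridional x) (meridional y) (meridional w)).
Qed.

Lemma torus_cocycle_near v : ~ K v -> cocycle_near tau v.
Proof.
have [r [x [y [-> r0 h]]]] := tube_surj v => nK.
have p0 := @pi_gt0 R.
set v0 := tube r x y.
have cN : continuous (fun v : 'rV[R]_3 => (meridional v).1 ^+ 2 + (meridional v).2 ^+ 2).
  have cm := @continuous_meridional R.
  by apply: continuous_addfun; apply: continuous_mulfun;
     (apply: continuous_fstfun || apply: continuous_sndfun).
have N0 : (meridional v0).1 ^+ 2 + (meridional v0).2 ^+ 2 = r ^+ 2.
  by rewrite meridional_tube//= !exprMn -mulrDr cos2Dsin2 mulr1.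
have near_h e : 0 < 2 + r * cos y -> 0 < e ->
    \forall w \near v0, exists2 al, has_angle (horizontal w) al & `|al - x| < e.
  move=> h0 e0; exact: (continuous_horizontal (near_angle (horizontal_angle x h0) e0)).
have near_m e : 0 < r -> 0 < e ->
    \forall w \near v0, exists2 be, has_angle (meridional w) be & `|be - y| < e.
  move=> h0 e0; exact: (continuous_meridional (near_angle (meridional_angle x h0 h) e0)).
have [r1|r1|r1] := ltgtP r 1.
- exists [set v | inside v /\ 0 < dotdir x (horizontal v)]; last exact: cocycle_inside.
  have h0 : 0 < 2 + r * cos y by apply: tube_gt0; lra.
  have n1 : \forall w \near v0, (meridional w).1 ^+ 2 + (meridional w).2 ^+ 2 < 1.
    by apply: (cvgr_lt _ (cN v0)); rewrite N0 expr_lt1.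
  apply: filterS2 n1 (near_h (pi / 2) h0 _); last by lra.
  move=> w w1 [al hal al1]; split; first exact: ltW.
  exact: dotdir_angle hal al1.
- exists [set v | ~~ inside v /\ 0 < dotdir y (meridional v)]; last exact: cocycle_outside.
  have n1 : \forall w \near v0, 1 < (meridional w).1 ^+ 2 + (meridional w).2 ^+ 2.
    by apply: (cvgr_gt _ (cN v0)); rewrite N0 expr_gt1// ltW.
  apply: filterS2 n1 (near_m (pi / 2) _ _); [|lra|lra].
  move=> w w1 [be hbe be1]; split; first by rewrite /inside -ltNge.
  exact: dotdir_angle hbe be1.
- have fz : off_lift K (x, y) by rewrite /off_lift /= -tube1 -r1.
  have [e e0 box] := open_box open_off_lift fz.
  pose e' := Num.min e 1.
  have e'0 : 0 < e' by rewrite lt_min e0 ltr01.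
  have e'e : e' <= e by rewrite ge_min lexx.
  eexists; last first.
    apply: (@cocycle_sheet (x, y) e') => //; first by rewrite ge_min lexx orbT.
    by move=> z' h1 h2; apply: box; apply: lt_le_trans e'e.
  have r00 : 0 < r by rewrite r1.
  have h0 : 0 < 2 + r * cos y by apply: tube_gt0; rewrite r1; lra.
  exact: filterS2 (near_h _ h0 e'0) (near_m _ r00 e'0).
Qed.

Lemma monodromy_longitude (g : R -> 'rV[R]_3) (r : R -> R) x0 y0 :
  regular_path tau g -> g 1 = g 0 ->
  (forall t, 0 <= t <= 1 -> 0 <= r t <= 1 /\ g t = tube (r t) (x0 + 2 * pi * t) y0) ->
  monodromy tau g 0 1 = a (- 1).
Proof.
move=> rg g10 gE; have p0 := @pi_gt0 R.
have h01 : 0 <= (0 : R) <= 1 by rewrite lexx ler01.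
have ang t : 0 <= t <= 1 -> has_angle (horizontal (g t)) (x0 + 2 * pi * t).
  by move=> /gE[r1 ->]; apply: horizontal_angle; apply: tube_gt0; lra.
have ins t : 0 <= t <= 1 -> inside (g t).
  move=> /gE[/andP[r0 r1] ->]; rewrite inside_tube//.
  by apply: tube_ge0; rewrite r0; lra.
rewrite (@monodromy_potential R S _ tau g 0 1
   (fun t => a (lag (horizontal (g t)) (x0 + 2 * pi * t)))) //.
  have := lagD2piZ 1 (ang 0 h01); rewrite mulr0 addr0 g10 mulr1 => ->.
  by rewrite -(int_homN aD) -aD; congr a; ring.
move=> t0 t01; exists 2^-1; first by rewrite invr_gt0.
move=> t t1 tt; rewrite /tau !ins//= (turnE (ang _ t01) (ang _ t1)).
  by rewrite -aD; congr a; ring.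
have -> : x0 + 2 * pi * t0 - (x0 + 2 * pi * t) = 2 * pi * (t0 - t) by ring.
rewrite normrM gtr0_norm ?mulr_gt0// distrC; nra.
Qed.

(** The base point is on the torus, where [inside] holds: the loop enters and leaves
the exterior through the sheet of that point, which conjugates the result. *)
Lemma monodromy_meridian (g : R -> 'rV[R]_3) (r : R -> R) x0 y0 :
  regular_path tau g -> off_lift K (x0, y0) ->
  g 0 = tube 1 x0 y0 -> g 1 = g 0 ->
  (forall t, 0 < t < 1 -> 1 < r t < 2 /\ g t = tube (r t) x0 (y0 + 2 * pi * t)) ->
  exists k, monodromy tau g 0 1 = ((a k)^-1 * b (- 1) * a k)%g.
Proof.
move=> rg fz g0 g10 gE; have p0 := @pi_gt0 R.
have h01 : 0 <= (0 : R) <= 1 by rewrite lexx ler01.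
have out t : 0 < t < 1 -> ~~ inside (g t).
  move=> /gE[/andP[r0 r1] ->]; rewrite inside_tube -?ltNge//; first lra.
  by apply: tube_ge0; lra.
have ang t : 0 < t < 1 -> has_angle (meridional (g t)) (y0 + 2 * pi * t).
  move=> /gE[/andP[r0 r1] ->]; apply: meridional_angle; first lra.
  by apply: tube_ge0; lra.
have [e e0 box] := open_box open_off_lift fz.
have near_end t u : 0 < t < 1 -> `|2 * pi * t - 2 * pi * u%:~R| < e ->
   sheet (g t) = b ((D (x0, y0)).2 + u + lag (meridional (g t)) (y0 + 2 * pi * t)).
  move=> t01 te; rewrite /sheet (negbTE (out _ t01)).
  have [/andP[r1 r2] gt] := gE _ t01.
  have h : has_angle (horizontal (g t)) x0.
    by rewrite gt; apply: horizontal_angle; apply: tube_gt0; lra.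
  have j : joined R (off_lift K) (x0, y0 + 2 * pi * t) (translate (x0, y0) (0, u)).
    have -> : (x0, y0 + 2 * pi * t) =
        translate (x0, y0 + (2 * pi * t - 2 * pi * u%:~R)) (0, u).
      by rewrite /translate /= mulr0 addr0; congr (_, _); ring.
    apply: (joined_translate (0, u) off_lift_translate).
    apply: (joined_box box) => /=; rewrite ?subrr ?normr0//.
    by rewrite addrAC subrr add0r.
  by case: (deck_lag h (ang _ t01) fz j).
have i0 : inside (g 0) by rewrite g0 inside_tube//; apply: tube_ge0; lra.
have tau0 : tau (g 0) (g 0) = 1%g.
  have [A nA cA] := rg.2 0 h01.
  by apply: (cocycle_refl cA); exact: nbhs_singleton nA.
have tau_out t t' : 0 < t < 1 -> 0 < t' < 1 -> `|t' - t| < 2^-1 ->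
    tau (g t) (g t') = b (lag (meridional (g t')) (y0 + 2 * pi * t') -
                          lag (meridional (g t)) (y0 + 2 * pi * t)).
  move=> t1 t2 tt; rewrite /tau (negbTE (out _ t1)) (negbTE (out _ t2)) /=.
  rewrite (turnE (ang _ t1) (ang _ t2))//.
  have -> : y0 + 2 * pi * t - (y0 + 2 * pi * t') = 2 * pi * (t - t') by ring.
  by rewrite normrM gtr0_norm ?mulr_gt0// distrC; nra.
have tau_in t : 0 < t < 1 -> tau (g 0) (g t) = ((sheet (g 0))^-1 * sheet (g t))%g.
  by move=> t1; rewrite /tau i0 (negbTE (out _ t1)).
set A := sheet (g 0).
have [k Ak] : exists k, A = a k by exists (D (angles (g 0))).1; rewrite /A /sheet i0.
(* at the end of the loop, b (- 1) makes up for the turn of the meridional angle *)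
pose s t : S := if t == 0 then A else if t == 1 then (b (- 1) * A)%g
  else b ((D (x0, y0)).2 + lag (meridional (g t)) (y0 + 2 * pi * t)).
exists k; rewrite -Ak.
rewrite (@monodromy_potential R S _ tau g 0 1 s) //.
  by rewrite /s eqxx oner_eq0 eqxx mulgA.
have sint t : 0 < t < 1 ->
    s t = b ((D (x0, y0)).2 + lag (meridional (g t)) (y0 + 2 * pi * t)).
  by move=> /andP[t0 t1]; rewrite /s gt_eqF// lt_eqF.
pose d := Num.min 2^-1 (e / (2 * pi)).
have d0 : 0 < d by rewrite lt_min invr_gt0 ltr0n divr_gt0 ?mulr_gt0.
have d2 : d <= 2^-1 by rewrite ge_min lexx.
have de (t : R) : `|t| < d -> `|2 * pi * t| < e.
  rewrite lt_min => /andP[_]; rewrite ltr_pdivlMr ?mulr_gt0// => h.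
  by rewrite normrM gtr0_norm ?mulr_gt0// mulrC.
move=> t0 /andP[t00 t01].
have [t0E|t0n] := eqVneq t0 0; last have [t0E|t0n1] := eqVneq t0 1.
- subst t0; exists d => // t /andP[t1 t2]; rewrite subr0 => tt.
  have [->|tn] := eqVneq t 0; first by rewrite tau0 mulg1.
  have tlt : 0 < t < 1 by rewrite lt_neqAle eq_sym tn t1 /=; move: tt; rewrite ltr_norml; lra.
  rewrite tau_in// (near_end t 0)//; last by rewrite mulr0 subr0; exact: de.
  by rewrite sint// /s eqxx mulVKg addr0.
- subst t0; exists d => // t /andP[t1 t2] tt.
  have [->|tn] := eqVneq t 1; first by rewrite g10 tau0 mulg1.
  have tlt : 0 < t < 1.
    by rewrite [t < 1]lt_neqAle tn t2 andbT; move: tt; rewrite ltr_norml; lra.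
  rewrite g10 tau_in// (near_end t 1)//; last first.
    have -> : 2 * pi * t - 2 * pi * 1%:~R = 2 * pi * (t - 1) :> R by ring.
    exact: de.
  rewrite sint// /s oner_eq0 eqxx -mulgA mulVKg -bD; congr b; ring.
- have t0i : 0 < t0 < 1 by rewrite !lt_neqAle eq_sym t0n t0n1 t00 t01.
  exists (Num.min 2^-1 (Num.min t0 (1 - t0))).
    by rewrite !lt_min; lra.
  move=> t t1; rewrite !lt_min => /andP[tt /andP[tt1 tt2]].
  have ti : 0 < t < 1 by move: tt1 tt2; rewrite !ltr_norml; lra.
  by rewrite tau_out// !sint// -bD; congr b; ring.
Qed.

End TorusCocycle.

(** * Monodromy and change of base point for loops *)

Lemma clamp_idP (R : realType) (t : R) : 0 <= t <= 1 -> clamp t = t.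
Proof. by move=> t01; apply: clamp_id; rewrite /= in_itv. Qed.

Lemma clamp_le0 (R : realType) (t : R) : t <= 0 -> clamp t = 0.
Proof.
by move=> t0; rewrite /clamp (min_idPr (le_trans t0 ler01)) (max_idPl t0).
Qed.

Lemma clamp_ge1 (R : realType) (t : R) : 1 <= t -> clamp t = 1.
Proof. by move=> t1; rewrite /clamp (min_idPl t1) (max_idPr ler01). Qed.

Lemma clamp01 (R : realType) (t : R) : 0 <= clamp t <= 1.
Proof. by have := clamp_itv t; rewrite /= in_itv. Qed.

Lemma loop_catE (R : realType) (X : topologicalType) (b : X) (f g : loop R b) t :
  loop_cat f g t = if 2 * t - 1 <= 0 then f (2 * t) else g (2 * t - 1).
Proof. by []. Qed.

Section BasePointChange.
Variables (R : realType) (X : topologicalType) (b e : X) (d : R -> X).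
Hypotheses (d_cont : continuous d) (d0 : d 0 = b) (d1 : d 1 = e).
Implicit Types f g : loop R e.

Lemma continuous_loop_clamp f : continuous (fun t => f (clamp t)).
Proof. exact: loop_clamp_continuous. Qed.

Definition conj_path (h : R -> X) (t : R) : X :=
  if 3 * t - 1 <= 0 then d (clamp (3 * t))
  else if 3 * t - 2 <= 0 then h (3 * t - 1) else d (clamp (3 - 3 * t)).

Lemma conj_loop_continuous f :
  continuous (conj_path (fun t => f (clamp t))).
Proof.
have cf := @continuous_loop_clamp f.
apply: (@continuous_paste R R X (fun t => 3 * t - 1) (fun t => d (clamp (3 * t)))
 (fun t => if 3 * t - 2 <= 0 then f (clamp (3 * t - 1)) else d (clamp (3 - 3 * t)))).
- by prove_continuous.
- by apply: (continuous_compfun (g := d) _ d_cont); prove_continuous.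
- apply: (@continuous_paste R R X (fun t => 3 * t - 2)
    (fun t => f (clamp (3 * t - 1))) (fun t => d (clamp (3 - 3 * t)))).
  + by prove_continuous.
  + have cl : continuous (fun t : R => 3 * t - 1) by prove_continuous.
    exact: (continuous_compfun cl cf).
  + by apply: (continuous_compfun (g := d) _ d_cont); prove_continuous.
  + move=> t t0; rewrite clamp_ge1; last lra.
    by rewrite clamp_ge1; [rewrite loop1 d1|lra].
- move=> t t0; rewrite ifT; last lra.
  by rewrite (clamp_le0 (t := 3 * t - 1)) ?clamp_ge1 ?loop0//; lra.
Qed.

Definition conj_loop f : loop R b.
refine (@Loop R X b (conj_path (fun t => f (clamp t))) _ _ _).
- exact: continuous_subspaceT (@conj_loop_continuous f).
- by rewrite /conj_path ifT ?mulr0 ?clamp0//; lra.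
- rewrite /conj_path ifF; last lra.
  by rewrite ifF; [rewrite mulr1 subrr clamp0|lra].
Defined.

Arguments conj_loop : simpl never.

Lemma conj_loopE f t : 0 <= t <= 1 -> conj_loop f t =
  if 3 * t - 1 <= 0 then d (3 * t)
  else if 3 * t - 2 <= 0 then f (3 * t - 1) else d (3 - 3 * t).
Proof.
move=> t01; rewrite /conj_loop /= /conj_path.
by case: ifPn => h1; [rewrite clamp_idP//; lra|case: ifPn => h2; rewrite clamp_idP//; lra].
Qed.

Lemma conj_loop_homotopic f g : loop_homotopic f g ->
  loop_homotopic (conj_loop f) (conj_loop g).
Proof.
move=> /loop_homotopic_extend[H [cH Hf Hg H0 H1]].
apply: (@loop_homotopic_total _ _ _ (fun x => conj_path (fun t => H (x.1, t)) x.2)) => /=.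
- rewrite /conj_path.
  apply: (@continuous_paste R _ X (fun x : R * R => 3 * x.2 - 1) (fun x => d (clamp (3 * x.2)))
   (fun x : R * R => if 3 * x.2 - 2 <= 0 then H (x.1, 3 * x.2 - 1) else d (clamp (3 - 3 * x.2)))).
  + by prove_continuous.
  + by apply: (continuous_compfun (g := d) _ d_cont); prove_continuous.
  + apply: (@continuous_paste R _ X (fun x : R * R => 3 * x.2 - 2)
      (fun x => H (x.1, 3 * x.2 - 1)) (fun x => d (clamp (3 - 3 * x.2)))).
    * by prove_continuous.
    * by apply: (continuous_compfun (g := H) _ cH); prove_continuous.
    * by apply: (continuous_compfun (g := d) _ d_cont); prove_continuous.
    * move=> x x0; rewrite H1; last lra.
      by rewrite clamp_ge1; [rewrite d1|lra].
  + move=> x x0; rewrite ifT; last lra.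
    by rewrite H0 ?clamp_ge1 ?d1//; lra.
- by move=> t _; rewrite /conj_loop /= /conj_path !Hf.
- by move=> t _; rewrite /conj_loop /= /conj_path !Hg.
- by move=> s _; rewrite /conj_path ifT ?mulr0 ?clamp0//; lra.
- move=> s _; rewrite /conj_path ifF; last lra.
  by rewrite ifF; [rewrite mulr1 subrr clamp0|lra].
Qed.

(** The loop d f d^-1 d g d^-1, whose middle part d^-1 d is cut at height [z.1]. *)
Definition spur (f g : loop R e) (z : R * R) : X :=
  if 6 * z.2 - 2 <= 0 then
    if 6 * z.2 - 1 <= 0 then d (clamp (6 * z.2)) else f (clamp (6 * z.2 - 1))
  else if 6 * z.2 - 4 <= 0 then d (clamp (Num.max (clamp z.1) `|6 * z.2 - 3|))
  else if 6 * z.2 - 5 <= 0 then g (clamp (6 * z.2 - 4))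
  else d (clamp (6 - 6 * z.2)).

Lemma spur_continuous f g : continuous (spur f g).
Proof.
have cf := @continuous_loop_clamp f; have cg := @continuous_loop_clamp g.
pose lin (k : R) := fun z : R * R => 6 * z.2 - k.
have cl k : continuous (lin k) by rewrite /lin; prove_continuous.
pose P1 z := d (clamp (lin 0 z)).
have E1 z : d (clamp (6 * z.2)) = P1 z by rewrite /P1 /lin subr0.
pose P2 z := f (clamp (lin 1 z)); pose P4 z := g (clamp (lin 4 z)).
pose P3 (z : R * R) := d (clamp (Num.max (clamp z.1) `|lin 3 z|)).
pose P5 (z : R * R) := d (clamp (6 - 6 * z.2)).
have c1 : continuous P1 by apply: (continuous_compfun (g := d) _ d_cont); prove_continuous.
have c2 : continuous P2.
  by apply: (continuous_compfun (f := lin 1) (g := fun t => f (clamp t)) _ cf).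
have c4 : continuous P4.
  by apply: (continuous_compfun (f := lin 4) (g := fun t => g (clamp t)) _ cg).
have c5 : continuous P5 by apply: (continuous_compfun (g := d) _ d_cont); prove_continuous.
have c3 : continuous P3.
  apply: (continuous_compfun (g := d) _ d_cont); prove_continuous.
  have h1 : continuous (fun z : R * R => clamp z.1) by prove_continuous.
  have h2 : continuous (fun z => `|lin 3 z|) by apply: continuous_normfun.
  by move=> z; exact: continuous_max (h1 z) (h2 z).
have c45 : continuous (fun z => if lin 5 z <= 0 then P4 z else P5 z).
  apply: (continuous_paste (cl 5) c4 c5) => z; rewrite /lin /P4 /P5 => z0.
  rewrite clamp_ge1; last by rewrite /lin; lra.
  rewrite clamp_ge1; last lra.
  by rewrite loop1 d1.
have c12 : continuous (fun z => if lin 1 z <= 0 then P1 z else P2 z).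
  apply: (continuous_paste (cl 1) c1 c2) => z; rewrite /lin /P1 /P2 => z0.
  rewrite clamp_ge1; last by rewrite /lin; lra.
  by rewrite clamp_le0 ?loop0//; rewrite /lin; lra.
have c345 : continuous (fun z => if lin 4 z <= 0 then P3 z else
    if lin 5 z <= 0 then P4 z else P5 z).
  apply: (continuous_paste (cl 4) c3 c45) => z; rewrite /lin /P3 /P4 => z0.
  rewrite ifT; last lra.
  rewrite clamp_ge1; last by rewrite le_max [in `|_|]/lin ger0_norm; lra.
  by rewrite clamp_le0 ?loop0//; rewrite /lin; lra.
have := continuous_paste (cl 2) c12 c345; rewrite /spur /lin => H.
have -> : (fun z : R * R => if 6 * z.2 - 2 <= 0 then
    if 6 * z.2 - 1 <= 0 then d (clamp (6 * z.2)) else f (clamp (6 * z.2 - 1))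
  else if 6 * z.2 - 4 <= 0 then d (clamp (Num.max (clamp z.1) `|6 * z.2 - 3|))
  else if 6 * z.2 - 5 <= 0 then g (clamp (6 * z.2 - 4))
  else d (clamp (6 - 6 * z.2))) = (fun z : R * R => if 6 * z.2 - 2 <= 0 then
    if 6 * z.2 - 1 <= 0 then P1 z else P2 z
  else if 6 * z.2 - 4 <= 0 then P3 z
  else if 6 * z.2 - 5 <= 0 then P4 z else P5 z).
  by apply/funext => z; rewrite E1.
apply: H => z z0; rewrite ifF; last lra.
rewrite ifT; last lra.
rewrite /P2 /P3 clamp_ge1; last by rewrite /lin; lra.
rewrite clamp_ge1 ?loop1 ?d1// le_max /lin.
by apply/orP; right; rewrite ler_normr; apply/orP; right; lra.
Qed.

(** Cut the spur d^-1 d down to the constant loop at [e]; what is left is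
[conj_loop (loop_cat f g)] up to a change of parameter. *)
Lemma conj_loop_cat f g :
  loop_homotopic (loop_cat (conj_loop f) (conj_loop g)) (conj_loop (loop_cat f g)).
Proof.
have cS := @spur_continuous f g.
have cS1 : continuous (fun t => spur f g (1, t)).
  have cp : continuous (fun t : R => (1 : R, t)) by prove_continuous.
  exact: (continuous_compfun cp cS).
have S0 s : spur f g (s, 0) = b.
  rewrite /spur /= mulr0; do 2 (rewrite ifT; last lra).
  by rewrite clamp0.
have S1 s : spur f g (s, 1) = b.
  rewrite /spur /= !mulr1; do 3 (rewrite ifF; last lra).
  by rewrite subrr clamp0.
pose w := @Loop R X b (fun t => spur f g (1, t)) (continuous_subspaceT cS1) (S0 1) (S1 1).
have h1 : loop_homotopic (loop_cat (conj_loop f) (conj_loop g)) w.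
  apply: (@loop_homotopic_total _ _ _ (spur f g)) => //.
  move=> t t01; have {}t01 : 0 <= t <= 1 by move: t01; rewrite /= in_itv.
  apply: esym; have -> : loop_cat (conj_loop f) (conj_loop g) t =
    if 2 * t - 1 <= 0 then conj_loop f (2 * t) else conj_loop g (2 * t - 1) by [].
  rewrite /spur clamp0; cbn [fst snd].
  case: (leP (2 * t - 1) 0) => h.
    rewrite conj_loopE; last lra.
    case: ifPn => k1.
      by rewrite ifT; [rewrite ifT; [congr d; rewrite clamp_idP; lra|lra]|lra].
    case: ifPn => k2.
      by rewrite ifT; [rewrite ifF; [congr (f _); rewrite clamp_idP; lra|lra]|lra].
    case: (leP (6 * t - 2) 0) => k3; first by exfalso; lra.
    rewrite ifT; last lra.
    by congr d; rewrite ler0_norm; [rewrite (max_idPr _) ?clamp_idP; lra|lra].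
  rewrite conj_loopE; last lra.
  rewrite [RHS]ifF; last lra.
  case: ifPn => k1.
    case: (leP (6 * t - 4) 0) => k3; last by exfalso; lra.
    by congr d; rewrite ger0_norm; [rewrite (max_idPr _) ?clamp_idP; lra|lra].
  case: ifPn => k2.
    rewrite ifF; last lra.
    by rewrite ifT; [congr (g _); rewrite clamp_idP; lra|lra].
  rewrite ifF; last lra.
  by rewrite ifF; [congr d; rewrite clamp_idP; lra|lra].
have h2 : loop_homotopic w (conj_loop (loop_cat f g)).
  (* u stands still while w rests at e, between the times 1/3 and 2/3 *)
  pose u (t : R) := 3^-1 * clamp (6 * t) + 6^-1 * clamp (6 * t - 1) +
    6^-1 * clamp (6 * t - 4) + 3^-1 * clamp (6 * t - 5).
  apply: (@loop_homotopic_reparam R X b (conj_loop (loop_cat f g)) _ _ u id).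
  - by rewrite /u; prove_continuous.
  - exact: continuous_idfun.
  - move=> t t01; have {}t01 : 0 <= t <= 1 by move: t01; rewrite /= in_itv.
    have ut : 0 <= u t <= 1.
      have := clamp01 (6 * t); have := clamp01 (6 * t - 1).
      have := clamp01 (6 * t - 4); have := clamp01 (6 * t - 5); rewrite /u; lra.
    have -> : w t = spur f g (1, t) by [].
    rewrite clamp_idP// conj_loopE// /spur; cbn [fst snd]; move: ut; rewrite /u.
    case: (leP (6 * t - 2) 0) => k2.
      rewrite (clamp_le0 (t := 6 * t - 4)); last lra.
      rewrite (clamp_le0 (t := 6 * t - 5)); last lra.
      case: (leP (6 * t - 1) 0) => k1.
        rewrite (clamp_le0 (t := 6 * t - 1))// => ut.
        by rewrite ifT; [congr d; rewrite clamp_idP; lra|rewrite clamp_idP; lra].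
      rewrite (clamp_ge1 (t := 6 * t)); last lra.
      rewrite (clamp_idP (t := 6 * t - 1)); last lra.
      move=> ut; rewrite ifF; last lra.
      rewrite ifT; last lra.
      by rewrite loop_catE ifT; [congr (f _)|]; lra.
    rewrite (clamp_ge1 (t := 6 * t)); last lra.
    rewrite (clamp_ge1 (t := 6 * t - 1)); last lra.
    case: (leP (6 * t - 4) 0) => k4.
      rewrite (clamp_le0 (t := 6 * t - 4))// (clamp_le0 (t := 6 * t - 5)); last lra.
      move=> ut; rewrite clamp1 clamp_ge1; last by rewrite le_max lexx.
      rewrite ifF; last lra.
      rewrite ifT; last lra.
      rewrite d1 loop_catE ifT; last lra.
      by apply: etrans (esym (loop1 f)) _; congr (f _); lra.
    case: (leP (6 * t - 5) 0) => k5.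
      rewrite (clamp_le0 (t := 6 * t - 5))// (clamp_idP (t := 6 * t - 4)); last lra.
      move=> ut; rewrite ifF; last lra.
      rewrite ifT; last lra.
      by rewrite loop_catE ifF; [congr (g _)|]; lra.
    rewrite (clamp_ge1 (t := 6 * t - 4)); last lra.
    rewrite (clamp_idP (t := 6 * t - 5)); last lra.
    move=> ut; rewrite ifF; last lra.
    rewrite ifF; last lra.
    by congr d; rewrite clamp_idP; lra.
  - by move=> t; rewrite /= in_itv /= => t01; rewrite clamp_idP.
  - by rewrite /u !clamp_le0; lra.
  - by rewrite /u !clamp_ge1; lra.
apply/loop_classP; apply: etrans; first by apply/loop_classP; exact: h1.
by apply/loop_classP.
Qed.

End BasePointChange.

Section LoopMonodromy.
Variables (R : realType) (S : groupType) (X : topologicalType) (tau : X -> X -> S).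
Hypothesis tau_near : forall x, cocycle_near tau x.
Variable e : X.
Implicit Types f g : loop R e.

Lemma regular_continuous (g : R -> X) : continuous g -> regular_path tau g.
Proof. by move=> cg; split => // t _; exact: tau_near. Qed.

Definition loop_monodromy b (f : loop R b) : S :=
  monodromy tau (fun t => f (clamp t)) 0 1.

Lemma loop_monodromy_homotopic b (f g : loop R b) :
  loop_homotopic f g -> loop_monodromy f = loop_monodromy g.
Proof.
move=> /loop_homotopic_extend[H [cH Hf Hg H0 H1]].
have := @monodromy_square R S X tau H cH (fun s t _ _ => tau_near _).
have -> : (fun t => H (0, t)) = (fun t => f (clamp t)) by apply/funext => t; rewrite Hf.
have -> : (fun t => H (1, t)) = (fun t => g (clamp t)) by apply/funext => t; rewrite Hg.
have -> : (fun s => H (s, 0)) = (fun=> b) by apply/funext => s; rewrite H0.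
have -> : (fun s => H (s, 1)) = (fun=> b) by apply/funext => s; rewrite H1.
suff -> : monodromy tau (fun=> b) 0 (1 : R) = 1%g by rewrite mulg1 mul1g.
have [A nA cA] := tau_near b; have Ab := nbhs_singleton nA.
rewrite (monodromy_cocycle (A := A)) ?lexx ?ler01//; first exact: cocycle_refl Ab.
by apply: regular_continuous => x; exact: cst_continuous.
Qed.

Lemma loop_monodromy_cat f g :
  loop_monodromy (loop_cat f g) = (loop_monodromy f * loop_monodromy g)%g.
Proof.
have cF (h : loop R e) : regular_path tau (fun t => h (clamp t)).
  by apply: regular_continuous; exact: loop_clamp_continuous.
rewrite /loop_monodromy -(monodromyM _ _ 0 2^-1 1); congr (_ * _)%g; apply/esym.
  apply: (monodromy_affine (cF f) (cF (loop_cat f g))); [lra|lra|lra|].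
  move=> t t01; rewrite subr0 addr0 !clamp_idP//; last lra.
  by rewrite loop_catE ifT; [congr (f _)|]; lra.
apply: (monodromy_affine (cF g) (cF (loop_cat f g))); [lra|lra|lra|].
move=> t t01; rewrite !clamp_idP//; last lra.
rewrite loop_catE; case: ifPn => h; last by congr (g _); lra.
have -> : t = 0 by lra.
by rewrite loop0 mulr0 add0r mulfV// loop1.
Qed.

(** The constants are the monodromies along [d] and along its reverse; they cancel
when two loops are compared. *)
Lemma loop_monodromy_conj b (d : R -> X) (d_cont : continuous d)
    (d0 : d 0 = b) (d1 : d 1 = e) :
  exists c1 c2 : S, forall f, loop_monodromy (conj_loop d_cont d0 d1 f) =
    (c1 * loop_monodromy f * c2)%g.
Proof.
have cF (b' : X) (h : loop R b') : regular_path tau (fun t => h (clamp t)).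
  by apply: regular_continuous; exact: loop_clamp_continuous.
have cd : regular_path tau (fun t => d (clamp t)).
  by apply: regular_continuous; apply: (continuous_compfun (g := d) (@continuous_clamp R) d_cont).
have cd' : regular_path tau (fun t => d (1 - clamp t)).
  by apply: regular_continuous; apply: (continuous_compfun (g := d) _ d_cont); prove_continuous.
exists (monodromy tau (fun t => d (clamp t)) 0 1),
  (monodromy tau (fun t => d (1 - clamp t)) 0 1) => f.
rewrite /loop_monodromy -(monodromyM _ _ 0 3^-1 1).
rewrite -(monodromyM _ _ 3^-1 (2 / 3) 1) mulgA; congr (_ * _ * _)%g; apply/esym.
- apply: (monodromy_affine cd (cF _ (conj_loop d_cont d0 d1 f))); [lra|lra|lra|].
  move=> t t01; rewrite !clamp_idP//; last lra.
  rewrite conj_loopE; last lra.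
  rewrite ifT; last lra.
  by congr d; lra.
- apply: (monodromy_affine (cF _ f) (cF _ (conj_loop d_cont d0 d1 f))); [lra|lra|lra|].
  move=> t t01; rewrite !clamp_idP//; last lra.
  rewrite conj_loopE; last lra.
  case: ifPn => h.
    have -> : t = 0 by lra.
    by rewrite loop0 mulr0 add0r mulfV// d1.
  rewrite ifT; last lra.
  by congr (f _); lra.
apply: (monodromy_affine cd' (cF _ (conj_loop d_cont d0 d1 f))); [lra|lra|lra|].
move=> t t01; rewrite !clamp_idP//; last lra.
rewrite conj_loopE; last lra.
rewrite [RHS]ifF; last lra.
case: ifPn => h; last by congr d; lra.
have t0 : t = 0 by lra.
by rewrite t0 subr0 d1; apply: etrans (esym (loop1 f)) _; congr (f _); lra.
Qed.

End LoopMonodromy.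

(** * Loops around the two solid tori *)

(** The depth, on either side of the torus, of loops that touch the torus only at
their base point. *)
Definition hump (R : realType) (t : R) : R := 2 * t * (1 - t).

Definition ramp (R : realType) (z : R) (n : int) (t : R) : R := z + 2 * pi * n%:~R * t.

Section Complement.
Variables (R : realType) (K : set 'rV[R]_3) (X : topologicalType).
Variables (i : X -> 'rV[R]_3) (j : 'rV[R]_3 -> X).
Hypothesis iK : forall x, ~ K (i x).
Hypothesis ij : forall v, ~ K v -> i (j v) = v.
Hypothesis ji : forall x, j (i x) = x.
Hypothesis j_cont : forall (U : topologicalType) (f : U -> 'rV[R]_3),
  continuous f -> (forall u, ~ K (f u)) -> continuous (fun u => j (f u)).
Hypothesis K_surface : forall v, K v -> exists x y, v = torus_point x y.

Lemma avoid_tube (r x y : R) : 0 <= r -> 0 <= 2 + r * cos y -> r != 1 ->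
  ~ K (tube r x y).
Proof.
move=> r0 h r1 /K_surface[x' [y' E]].
have := meridional_tube x h; rewrite E -tube1 meridional_tube; last by apply: tube_ge0; lra.
rewrite !mul1r => -[c s]; have := cos2Dsin2 y'; rewrite c s !exprMn -mulrDr.
rewrite cos2Dsin2 mulr1 => /eqP; rewrite sqrp_eq1//.
by rewrite (negbTE r1).
Qed.

(** [1 + side o * r] is the tube radius at depth [r], outside the torus if [o] holds
and inside otherwise. *)
Definition side (o : bool) : R := if o then 1 else - 1.

Lemma avoid_side o (r x y : R) : 0 < r <= 1 -> ~ K (tube (1 + side o * r) x y).
Proof.
move=> r01; have h : 0 <= 1 + side o * r <= 2 by rewrite /side; case: o; lra.
apply: avoid_tube; [lra|exact: tube_ge0|].
rewrite -subr_eq0 addrAC subrr add0r mulf_neq0//; last by apply: lt0r_neq0; lra.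
by rewrite /side; case: ifP => _; rewrite ?oppr_eq0 oner_neq0.
Qed.

Definition lifted (e : X) (f : loop R e) o (r x y : R -> R) :=
  [/\ continuous r, continuous x, continuous y &
      forall t, 0 <= t <= 1 -> i (f t) = tube (1 + side o * r t) (x t) (y t)].

Lemma lifted_ex e (r x y : R -> R) : continuous r -> continuous x -> continuous y ->
  (forall t, 0 <= t <= 1 -> ~ K (tube (r t) (x t) (y t))) ->
  i e = tube (r 0) (x 0) (y 0) -> i e = tube (r 1) (x 1) (y 1) ->
  exists f : loop R e, forall t, 0 <= t <= 1 -> i (f t) = tube (r t) (x t) (y t).
Proof.
move=> cr cx cy av e0 e1; have cc : continuous (@clamp R) by exact: continuous_clamp.
pose g t := j (tube (r (clamp t)) (x (clamp t)) (y (clamp t))).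
have cg : continuous g.
  apply: j_cont; last by move=> t; apply: av; exact: clamp01.
  apply: continuous_tube.
  - exact: (continuous_compfun cc cr).
  - exact: (continuous_compfun cc cx).
  - exact: (continuous_compfun cc cy).
have g0 : g 0 = e by rewrite /g clamp0 -e0 ji.
have g1 : g 1 = e by rewrite /g clamp1 -e1 ji.
exists (@Loop R X e g (continuous_subspaceT cg) g0 g1) => t t01.
by rewrite /= /g clamp_idP// ij//; exact: av.
Qed.

(** Interpolate the coordinates linearly.  Strictly between the end points of the
loops, the depth is positive as soon as the homotopy has left [f], and points of
positive depth are off [K]. *)
Lemma lifted_homotopic e (f g : loop R e) o (r x y r' x' y' : R -> R) :
  lifted f o r x y -> lifted g o r' x' y' ->
  (forall t, 0 <= t <= 1 -> 0 <= r t <= 1) ->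
  (forall t, 0 <= t <= 1 -> 0 <= r' t <= 1) ->
  (forall t, 0 < t < 1 -> 0 < r' t) ->
  [/\ r 0 = r' 0, x 0 = x' 0 & y 0 = y' 0] ->
  [/\ r 1 = r' 1, x 1 = x' 1 & y 1 = y' 1] ->
  loop_homotopic f g.
Proof.
move=> [cr cx cy fE] [cr' cx' cy' gE] r01 r01' r0' [er0 ex0 ey0] [er1 ex1 ey1].
have cc : continuous (@clamp R) by exact: continuous_clamp.
pose mix (u u' : R -> R) (z : R * R) :=
  (1 - clamp z.1) * u (clamp z.2) + clamp z.1 * u' (clamp z.2).
have cmix u u' : continuous u -> continuous u' -> continuous (mix u u').
  move=> cu cu'; rewrite /mix.
  have c2 : continuous (fun z : R * R => clamp z.2) by prove_continuous.
  have cu2 := continuous_compfun c2 cu; have cu2' := continuous_compfun c2 cu'.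
  by prove_continuous.
have mix0 u u' t : 0 <= t <= 1 -> mix u u' (0, t) = u t.
  by move=> t01; rewrite /mix /= clamp0 clamp_idP// subr0 mul1r mul0r addr0.
have mix1 u u' t : 0 <= t <= 1 -> mix u u' (1, t) = u' t.
  by move=> t01; rewrite /mix /= clamp1 clamp_idP// subrr mul1r mul0r add0r.
have mixE u u' s t : u (clamp t) = u' (clamp t) -> mix u u' (s, t) = u (clamp t).
  by move=> E; rewrite /mix /= -E; ring.
pose T z := tube (1 + side o * mix r r' z) (mix x x' z) (mix y y' z).
have h0 : 0 <= (0 : R) <= 1 by lra.
have h1 : 0 <= (1 : R) <= 1 by lra.
have TE0 s t : clamp t = 0 -> T (s, t) = i (f 0).
  by move=> t0; rewrite /T !mixE ?t0// fE.
have TE1 s t : clamp t = 1 -> T (s, t) = i (f 1).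
  by move=> t0; rewrite /T !mixE ?t0// fE.
have avT z : ~ K (T z).
  case: z => s t; have c01 := clamp01 t; have s01 := clamp01 s.
  have [t0|t0] := eqVneq (clamp t) 0; first by rewrite TE0.
  have [t1|t1] := eqVneq (clamp t) 1; first by rewrite TE1.
  have {t0 t1}ti : 0 < clamp t < 1 by rewrite !lt_neqAle eq_sym t0 t1.
  have [s0|s0] := eqVneq (clamp s) 0.
    rewrite /T /mix /= s0 subr0 !mul1r !mul0r !addr0 -fE//; exact: iK.
  have {s0}sp : 0 < clamp s by rewrite lt_neqAle eq_sym s0; case/andP: s01.
  apply: avoid_side; rewrite /mix /=.
  have := r01 _ c01; have := r01' _ c01; have := r0' _ ti; nra.
have cT : continuous T.
  have crm := cmix _ _ cr cr'.
  by apply: continuous_tube; [prove_continuous|exact: cmix|exact: cmix].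
apply: (@loop_homotopic_total R X e (fun z => j (T z))).
- exact: j_cont.
- by move=> t; rewrite /= in_itv /= => t01; rewrite /T !mix0// -fE// ji.
- by move=> t; rewrite /= in_itv /= => t01; rewrite /T !mix1// -gE// ji.
- by move=> s _; rewrite TE0 ?clamp0// ji loop0.
- by move=> s _; rewrite TE1 ?clamp1// ji loop1.
Qed.

Variables x0 y0 : R.
Hypothesis off0 : off_lift K (x0, y0).

Let e : X := j (tube 1 x0 y0).

Lemma i_base : i e = tube 1 x0 y0.
Proof. by rewrite /e ij// tube1. Qed.

Lemma i_base_translate w :
  i e = tube 1 (x0 + 2 * pi * w.1%:~R) (y0 + 2 * pi * w.2%:~R).
Proof. by rewrite i_base -[LHS](tube_translate 1 (x0, y0) w). Qed.

Let hump_cont : continuous (@hump R).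
Proof. by rewrite /hump; prove_continuous. Qed.

Let hump01 (t : R) : 0 <= t <= 1 -> 0 <= hump t <= 1.
Proof. by rewrite /hump; nra. Qed.

Let hump_gt0 (t : R) : 0 < t < 1 -> 0 < hump t.
Proof. by rewrite /hump; nra. Qed.

Let ramp_cont (z : R) n : continuous (ramp z n).
Proof. by rewrite /ramp; prove_continuous. Qed.

Lemma straight_ex o (w : int * int) : exists f : loop R e,
  lifted f o (@hump R) (ramp x0 w.1) (ramp y0 w.2).
Proof.
have [||||||f fE] := @lifted_ex e (fun t => 1 + side o * hump t) (ramp x0 w.1) (ramp y0 w.2).
- by have hb : continuous (@hump R) := @hump_cont; prove_continuous.
- exact: ramp_cont.
- exact: ramp_cont.
- move=> t t01.
  have [->|t0] := eqVneq t 0.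
    rewrite /hump /ramp !mulr0 mul0r mulr0 !addr0 -i_base; exact: iK.
  have [->|t1] := eqVneq t 1.
    rewrite /hump /ramp subrr !mulr0 !mulr1 addr0 -i_base_translate; exact: iK.
  have ti : 0 < t < 1 by rewrite !lt_neqAle eq_sym t0 t1.
  by apply: avoid_side; rewrite hump_gt0//; case/andP: (hump01 t01).
- by rewrite /hump /ramp !mulr0 mul0r mulr0 !addr0 i_base.
- by rewrite /hump /ramp subrr !mulr0 !mulr1 addr0 -i_base_translate.
by exists f; split => //.
Qed.

(** The loop of class [w] pushed off the torus to the side [o]. *)
Definition straight o w : loop R e := projT1 (cid (straight_ex o w)).

Lemma straightP o w : lifted (straight o w) o (@hump R) (ramp x0 w.1) (ramp y0 w.2).
Proof. exact: projT2 (cid (straight_ex o w)). Qed.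

(** The concatenation touches the torus at its middle, but [lifted_homotopic] only
asks the straight loop to stay off the torus. *)
Lemma straightM o w w' :
  loop_class (straight o (w.1 + w'.1, w.2 + w'.2)) =
  (loop_class (straight o w) * loop_class (straight o w'))%g.
Proof.
rewrite -[RHS]/(pi1_mul _ _) pi1_mulE; apply/esym/loop_classP.
have [_ _ _ fE] := straightP o w; have [_ _ _ gE] := straightP o w'.
pose glue (u v : R -> R) (t : R) := if 2 * t - 1 <= 0 then u (2 * t) else v (2 * t - 1).
have cglue (u v : R -> R) : continuous u -> continuous v -> u 1 = v 0 -> continuous (glue u v).
  move=> cu cv uv; have ch : continuous (fun t : R => 2 * t - 1) by prove_continuous.
  have cd : continuous (fun t : R => 2 * t) by prove_continuous.
  apply: (@continuous_paste R R R (fun t => 2 * t - 1) (fun t => u (2 * t))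
    (fun t => v (2 * t - 1)) ch); first exact: (continuous_compfun cd cu).
    exact: (continuous_compfun ch cv).
  by move=> t t0; rewrite t0 -uv; congr (u _); lra.
have ramp1 (z : R) m n : ramp z m 1 = ramp (z + 2 * pi * m%:~R) n 0.
  by rewrite /ramp mulr1 mulr0 addr0.
have glue0 (u v : R -> R) : glue u v 0 = u 0 by rewrite /glue ifT ?mulr0//; lra.
have glue1 (u v : R -> R) : glue u v 1 = v 1.
  by rewrite /glue ifF; [congr (v _)|]; lra.
have b0 : hump 0 = 0 :> R by rewrite /hump; lra.
have b1 : hump 1 = 0 :> R by rewrite /hump; lra.
apply: (@lifted_homotopic e _ _ o (glue (@hump R) (@hump R))
  (glue (ramp x0 w.1) (ramp (x0 + 2 * pi * w.1%:~R) w'.1))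
  (glue (ramp y0 w.2) (ramp (y0 + 2 * pi * w.2%:~R) w'.2)) _ _ _ _ (straightP _ _)).
- split.
  + by apply: cglue; rewrite ?b0.
  + exact: cglue.
  + exact: cglue.
  + move=> t t01; rewrite loop_catE /glue; case: ifPn => h.
      by rewrite fE//; lra.
    rewrite gE; last lra.
    rewrite -(tube_translate _ (ramp x0 w'.1 (2 * t - 1), ramp y0 w'.2 (2 * t - 1)) w).
    by congr tube; rewrite /translate /ramp; cbn [fst snd]; ring.
- by move=> t t01; rewrite /glue; case: ifPn => h; apply: hump01; lra.
- exact: hump01.
- exact: hump_gt0.
- by rewrite !glue0 b0 /ramp !mulr0 !addr0.
- by rewrite !glue1 b1 /ramp !mulr1 /= !intrD; split => //; ring.
Qed.

(** A loop of the torus off [K] can be pushed to both sides. *)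
Lemma straight_period w : joined R (off_lift K) (x0, y0) (translate (x0, y0) w) ->
  loop_class (straight false w) = loop_class (straight true w).
Proof.
move=> [z [cz z0 z1 az]].
have c1 : continuous (fun t => (z t).1) by apply: continuous_fstfun.
have c2 : continuous (fun t => (z t).2) by apply: continuous_sndfun.
have [||||||f fE] := @lifted_ex e (fun=> 1) (fun t => (z t).1) (fun t => (z t).2).
- exact: continuous_constfun.
- exact: c1.
- exact: c2.
- by move=> t _; rewrite tube1; exact: az.
- by rewrite z0 i_base.
- by rewrite z1 -i_base_translate.
have H o : loop_homotopic f (straight o w).
  apply: (@lifted_homotopic e f _ o (fun=> 0) (fun t => (z t).1) (fun t => (z t).2)
    _ _ _ _ (straightP o w)).
  - by split; [exact: continuous_constfun|exact: c1|exact: c2|move=> t /fE ->; rewrite mulr0 addr0].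
  - by move=> t _; lra.
  - exact: hump01.
  - exact: hump_gt0.
  - by rewrite z0 /ramp /hump /= !mulr0 mul0r !addr0.
  - by rewrite z1 /ramp /hump /= !mulr1 subrr mulr0.
have /loop_classP <- := H false; exact/loop_classP/H.
Qed.

(** At depth 1 and angles [xs], [ys] the displacement along [w] is invisible.  So the
loop that goes there, moves along [w] and comes back is at the same time one that
goes there and comes back without moving, and retracts. *)
Lemma straight_kill o w xs ys :
  (forall t, tube (1 + side o) (ramp xs w.1 t) (ramp ys w.2 t) = tube (1 + side o) xs ys) ->
  loop_class (straight o w) = 1%g.
Proof.
move=> Hk.
pose u (t : R) := Num.min 1 (Num.min (3 * t) (3 - 3 * t)).
have cu : continuous u.
  have h1 : continuous (fun t : R => 3 * t) by prove_continuous.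
  have h2 : continuous (fun t : R => 3 - 3 * t) by prove_continuous.
  have h3 : continuous (fun t : R => Num.min (3 * t) (3 - 3 * t)).
    by move=> t; exact: continuous_min (h1 t) (h2 t).
  have h0 : continuous (fun _ : R => 1 : R) by prove_continuous.
  by move=> t; exact: continuous_min (h0 t) (h3 t).
have u0 : u 0 = 0 by rewrite /u /Num.min; repeat (case: ifPn); rewrite -?leNgt; lra.
have u1 : u 1 = 0 by rewrite /u /Num.min; repeat (case: ifPn); rewrite -?leNgt; lra.
have u01 t : 0 <= t <= 1 -> 0 <= u t <= 1.
  by move=> t01; rewrite /u /Num.min; repeat (case: ifPn); rewrite -?leNgt; lra.
have ugt t : 0 < t < 1 -> 0 < u t.
  by move=> t01; rewrite /u /Num.min; repeat (case: ifPn); rewrite -?leNgt; lra.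
have umid t : 3^-1 <= t <= 2 / 3 -> u t = 1.
  by move=> t01; rewrite /u /Num.min; repeat (case: ifPn); rewrite -?leNgt; lra.
pose q z zs t := (1 - u t) * z + u t * zs.
have cq z zs : continuous (q z zs) by rewrite /q; prove_continuous.
pose qr z zs (n : int) t := q z zs t + 2 * pi * n%:~R * clamp (3 * t - 1).
have cqr z zs n : continuous (qr z zs n).
  by rewrite /qr; have hq := cq z zs; prove_continuous.
have q0 z zs : q z zs 0 = z by rewrite /q u0; lra.
have q1 z zs : q z zs 1 = z by rewrite /q u1; lra.
have qr0 z zs n : qr z zs n 0 = z by rewrite /qr q0 clamp_le0; lra.
have qr1 z zs n : qr z zs n 1 = z + 2 * pi * n%:~R.
  by rewrite /qr q1 clamp_ge1 ?mulr1; lra.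
have same t : 0 <= t <= 1 -> tube (1 + side o * u t) (qr x0 xs w.1 t) (qr y0 ys w.2 t) =
    tube (1 + side o * u t) (q x0 xs t) (q y0 ys t).
  move=> t01; have [t1|t1] := leP (3 * t - 1) 0.
    by rewrite /qr clamp_le0// !mulr0 !addr0.
  have [t2|t2] := leP 1 (3 * t - 1).
    rewrite /qr clamp_ge1// !mulr1.
    exact: (tube_translate _ (q x0 xs t, q y0 ys t) w).
  by rewrite /qr /q umid ?subrr ?mul0r ?add0r ?mul1r ?mulr1 ?Hk//; lra.
have [||||||f fE] := @lifted_ex e (fun t => 1 + side o * u t) (q x0 xs) (q y0 ys).
- by prove_continuous.
- exact: cq.
- exact: cq.
- move=> t t01.
  have [->|t0] := eqVneq t 0.
    rewrite u0 !q0 mulr0 addr0 -i_base; exact: iK.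
  have [->|t1] := eqVneq t 1.
    rewrite u1 !q1 mulr0 addr0 -i_base; exact: iK.
  have ti : 0 < t < 1 by rewrite !lt_neqAle eq_sym t0 t1.
  by apply: avoid_side; rewrite ugt//; case/andP: (u01 _ t01).
- by rewrite u0 !q0 mulr0 addr0 i_base.
- by rewrite u1 !q1 mulr0 addr0 i_base.
have h1 : loop_homotopic f (straight o w).
  apply: (@lifted_homotopic e f _ o u (qr x0 xs w.1) (qr y0 ys w.2) _ _ _ _ (straightP o w)) => //.
  - by split => // t t01; rewrite fE// same.
  - by rewrite u0 !qr0 /ramp /hump !mulr0 mul0r !addr0.
  - by rewrite u1 !qr1 /ramp /hump !mulr1 subrr mulr0.
have h2 : loop_homotopic (loop_cst R e) f.
  apply: (@lifted_homotopic e _ f o (fun=> 0) (fun=> x0) (fun=> y0) u (q x0 xs) (q y0 ys)) => //.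
  - split; [exact: continuous_constfun|exact: continuous_constfun|exact: continuous_constfun|].
    by move=> t _; rewrite mulr0 addr0 i_base.
  - by move=> t _; lra.
have /loop_classP <- := h1; rewrite -[RHS]/(pi1_one R e).
by apply/esym/loop_classP.
Qed.

Lemma joined_tube (r x y : R -> R) : continuous r -> continuous x -> continuous y ->
  (forall t, 0 <= t <= 1 -> ~ K (tube (r t) (x t) (y t))) ->
  joined R [set: X] (j (tube (r 0) (x 0) (y 0))) (j (tube (r 1) (x 1) (y 1))).
Proof.
move=> cr cx cy av; have cc : continuous (@clamp R) by exact: continuous_clamp.
exists (fun t => j (tube (r (clamp t)) (x (clamp t)) (y (clamp t)))); split => //.
- apply: j_cont; last by move=> t; apply: av; exact: clamp01.
  apply: continuous_tube.
  + exact: (continuous_compfun cc cr).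
  + exact: (continuous_compfun cc cx).
  + exact: (continuous_compfun cc cy).
- by rewrite clamp0.
- by rewrite clamp1.
Qed.

Lemma joined_base b : joined R [set: X] b e.
Proof.
have [r [x [y [ibE r0 h]]]] := tube_surj (i b).
have nK := @iK b; rewrite ibE in nK.
have near r' : 0 <= r' <= 2 -> ~ K (tube r' x y) -> joined R [set: X] (j (tube r' x y)) e.
  move=> r'02 nK'; pose o := 1 < r'.
  have oE : 1 + side o * `|r' - 1| = r'.
    rewrite /side /o; case: ltP => r'1.
      by rewrite gtr0_norm; lra.
    by rewrite ler0_norm; lra.
  have rho1 : 0 <= `|r' - 1| <= 1 by rewrite normr_ge0 ler_norml; lra.
  move: (`|r' - 1|) rho1 oE => rho rho1 oE.
  (* the depth is positive for 0 < t < 1, also when rho = 0 *)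
  pose rt (t : R) := 1 + side o * ((1 - t) * (rho + t)).
  have := @joined_tube rt (fun t => (1 - t) * x + t * x0) (fun t => (1 - t) * y + t * y0).
  have -> : rt 0 = r' by rewrite /rt subr0 mul1r addr0.
  have -> : rt 1 = 1 by rewrite /rt subrr mul0r mulr0 addr0.
  rewrite subr0 subrr !mul1r !mul0r !addr0 !add0r; apply.
  - by rewrite /rt; prove_continuous.
  - by prove_continuous.
  - by prove_continuous.
  move=> t t01; have [->|t0] := eqVneq t 0.
    by rewrite /rt subr0 !mul1r !mul0r !addr0 oE.
  have [->|t1] := eqVneq t 1.
    by rewrite /rt subrr !mul0r !mul1r mulr0 addr0 !add0r -i_base; exact: iK.
  have ti : 0 < t < 1 by rewrite !lt_neqAle eq_sym t0 t1.
  by apply: avoid_side; nra.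
rewrite -(ji b) ibE; have [r2|r2] := leP r 2; first by apply: near; rewrite // r0.
(* beyond radius 2, first move radially to radius 2 *)
apply: joined_trans (near 2 _ _); last 2 first.
- by rewrite lexx ler0n.
- apply: avoid_tube; [lra|apply: tube_ge0; lra|].
  by rewrite pnatr_eq1.
have := @joined_tube (fun t => (1 - t) * r + t * 2) (fun=> x) (fun=> y).
rewrite subr0 subrr !mul1r !mul0r addr0 add0r; apply.
- by prove_continuous.
- exact: continuous_constfun.
- exact: continuous_constfun.
move=> t t01; apply: avoid_tube.
- by nra.
- have := tube_ge0 (r := 2) y; rewrite ler0n lexx => /(_ isT) h2.
  have -> : 2 + ((1 - t) * r + t * 2) * cos y =
    (1 - t) * (2 + r * cos y) + t * (2 + 2 * cos y) by ring.
  by rewrite addr_ge0// mulr_ge0//; lra.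
- by rewrite gt_eqF//; nra.
Qed.

End Complement.

(** * The fundamental group of the complement *)

Section ChangeBasePoint.
Variables (R : realType) (X : topologicalType) (b e : X) (d : R -> X).
Hypotheses (d_cont : continuous d) (d0 : d 0 = b) (d1 : d 1 = e).

Definition pi1_conj (g : pi1 R e) : pi1 R b :=
  loop_class (conj_loop d_cont d0 d1 (loop_rep g)).

Lemma pi1_conjE (f : loop R e) :
  pi1_conj (loop_class f) = loop_class (conj_loop d_cont d0 d1 f).
Proof. by apply/loop_classP/conj_loop_homotopic/loop_classP/loop_repK. Qed.

Lemma pi1_conjM g h : pi1_conj (g * h)%g = (pi1_conj g * pi1_conj h)%g.
Proof.
rewrite -(loop_repK g) -(loop_repK h) -[(_ * _)%g in LHS]/(pi1_mul _ _) pi1_mulE.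
rewrite !pi1_conjE -[RHS]/(pi1_mul _ _) pi1_mulE.
exact/esym/loop_classP/conj_loop_cat.
Qed.

Lemma pi1_conjX g n : pi1_conj (g ^+ n)%g = (pi1_conj g ^+ n)%g.
Proof.
elim: n => [|n IH]; last by rewrite !expgS pi1_conjM IH.
by apply: (mulgI (pi1_conj (g ^+ 0)%g)); rewrite -pi1_conjM !expg0 !mulg1.
Qed.

End ChangeBasePoint.

Section TorusKnotGroup.
Variables (R : realType) (p q : int) (K : set 'rV[R]_3).
Hypotheses (cpq : coprimez p q) (p1 : 1 < `|p|) (q1 : 1 < `|q|).
Variables (c : R -> 'rV[R]_3) (x y : R -> R).
Hypothesis c_cont : continuous c.
Hypothesis c_inj : forall s t, c s = c t -> exists n : int, t = s + n%:~R.
Hypothesis c_range : range c = K.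
Hypotheses (x_cont : continuous x) (y_cont : continuous y).
Hypothesis cE : forall t, c t = torus_point (x t) (y t).
Hypothesis x_per : forall t, x (t + 1) = x t + 2 * pi * p%:~R.
Hypothesis y_per : forall t, y (t + 1) = y t + 2 * pi * q%:~R.
Variable X : topologicalType.
Variables (i : X -> 'rV[R]_3) (j : 'rV[R]_3 -> X).
Hypothesis i_cont : continuous i.
Hypothesis iK : forall x, ~ K (i x).
Hypothesis ij : forall v, ~ K v -> i (j v) = v.
Hypothesis ji : forall x, j (i x) = x.
Hypothesis j_cont : forall (U : topologicalType) (f : U -> 'rV[R]_3),
  continuous f -> (forall u, ~ K (f u)) -> continuous (fun u => j (f u)).

Let K_surface v : K v -> exists x y, v = torus_point x y.
Proof. by rewrite -c_range => -[t _ <-]; exists (x t), (y t). Qed.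

(** With [X] homeomorphic to the complement of [K] by [i] and [j], this is the case
of a curve on the standard torus. *)
Theorem torus_complement_torsion (b : X) : exists g : pi1 R b, generalized_torsion g.
Proof.
have p0 : p != 0 by apply/eqP => E; move: p1; rewrite E normr0.
have q0 : q != 0 by apply/eqP => E; move: q1; rewrite E normr0.
have K_open : open (off_lift K) := open_off_lift c_cont c_range cE x_per y_per.
have K_inv : lattice_invariant (off_lift K) by exact: off_lift_translate.
have mult w : period (off_lift K) w -> exists k, w = (p * k, q * k).
  exact: (period_multiple c_range x_cont y_cont cE x_per y_per cpq p0).
have [w pw w0] := essential_period c_cont c_inj c_range x_cont y_cont cE x_per y_per q0.
have [k wk] := mult _ pw.
case: pw => -[x0 y0] jw.
have off0 : off_lift K (x0, y0) by case: jw => f [_ <- _].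
have k0 : k != 0 by apply/eqP => E; apply: w0; rewrite wk E !mulr0.
have w1 : w.1 != 0 by rewrite wk mulf_neq0.
pose e : X := j (tube 1 x0 y0).
pose st := straight iK ij ji j_cont K_surface off0.
pose cl o w : pi1 R e := loop_class (st o w).
have clM o (m n m' n' : int) : cl o (m + m', n + n') = (cl o (m, n) * cl o (m', n'))%g.
  exact: (straightM iK ij ji j_cont K_surface off0 o (m, n) (m', n')).
have cl1 o (m m' : int) : cl o (m + m', 0) = (cl o (m, 0%R) * cl o (m', 0%R))%g.
  by rewrite -clM addr0.
have cl2 o (m m' : int) : cl o (0, m + m') = (cl o (0%R, m) * cl o (0%R, m'))%g.
  by rewrite -clM addr0.
(* the meridian shrinks to a point of the core, at radius 0 *)
have meridian_in : cl false (0, 1) = 1%g.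
  apply: (straight_kill iK ij ji j_cont K_surface off0 (xs := x0) (ys := y0)) => t.
  by rewrite /side subrr /tube /ramp /= !mul0r mulr0 mul0r !addr0.
(* the longitude shrinks to a point of the axis, at radius 2 and angle pi *)
have longitude_out : cl true (1, 0) = 1%g.
  apply: (straight_kill iK ij ji j_cont K_surface off0 (xs := x0) (ys := pi)) => t.
  rewrite /side /tube /ramp /= mulr0 mul0r addr0 cospi.
  have -> : 2 + (1 + 1) * -1 = 0 :> R by ring.
  by rewrite !mul0r.
have clE o (m n : int) : cl o (m, n) = (cl o (m, 0%R) * cl o (0%R, n))%g.
  by rewrite -clM addr0 add0r.
have cl_in (m n : int) : cl false (m, n) = cl false (m, 0).
  rewrite clE (int_hom_trivial (h := fun n => cl false (0, n)) (cl2 false) meridian_in).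
  by rewrite mulg1.
have cl_out (m n : int) : cl true (m, n) = cl true (0, n).
  rewrite clE (int_hom_trivial (h := fun n => cl true (n, 0)) (cl1 true) longitude_out).
  by rewrite mul1g.
pose X1 := cl false (1, 0); pose Y1 := cl true (0, 1).
have w_eq : cl false (w.1, 0) = cl true (0, w.2).
  rewrite -(cl_in w.1 w.2) -(cl_out w.1 w.2) -surjective_pairing.
  exact: (straight_period iK ij ji j_cont K_surface off0 jw).
have comm1 : commute (cl false (w.1, 0)) Y1.
  by rewrite /commute w_eq /Y1 -!cl2 addrC.
(* N is the absolute value of w.1 = p * k *)
have [N N0 commN] : exists2 N, (0 < N)%N & commute (X1 ^+ N)%g Y1.
  exists `|w.1|%N; first by rewrite absz_gt0.
  have := int_hom_pow (h := fun m => cl false (m, 0)) (cl1 false) `|w.1|%N.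
  rewrite -/X1 => <-; case: (w.1) comm1 => n //.
  rewrite NegzE (int_homN (h := fun m => cl false (m, 0)) (cl1 false)) abszN => h.
  by apply/commute_sym; rewrite -[cl false _]invgK; apply/commuteV/commute_sym.
have [S [a [a' [aD a'D ap a'q aa']]]] := noncommuting_rotations p1 q1.
have [D DP] := deck_index K_inv.
pose tau v v' := torus_cocycle D a a' (i v) (i v').
have tauK v : ~ K v -> cocycle_near (torus_cocycle D a a') v.
  exact: (torus_cocycle_near K_open K_inv mult DP aD a'D ap a'q).
have tau_near v : cocycle_near tau v.
  have [A nA cA] := tauK _ (@iK v); exists (i @^-1` A); first exact: i_cont.
  by move=> u u' u''; exact: cA.
have mon_conv (f : loop R e) : loop_monodromy tau f =
  monodromy (torus_cocycle D a a') (fun t => i (f (clamp t))) 0 1 by [].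
have reg_conv (f : loop R e) :
    regular_path (torus_cocycle D a a') (fun t => i (f (clamp t))).
  split; last by move=> t _; exact/tauK/iK.
  exact: (continuous_compfun (@loop_clamp_continuous R X e f) i_cont).
have ends (f : loop R e) : i (f (clamp 1)) = i (f (clamp 0)).
  by rewrite clamp0 clamp1 loop0 loop1.
have hump01 (t : R) : 0 <= t <= 1 -> 0 <= hump t <= 1 by rewrite /hump; nra.
have monX : loop_monodromy tau (st false (1, 0)) = a (- 1).
  have [_ _ _ fE] := straightP iK ij ji j_cont K_surface off0 false (1, 0).
  rewrite mon_conv.
  apply: (monodromy_longitude (r := fun t => 1 - hump t) (x0 := x0) (y0 := y0) aD
    (reg_conv _) (ends _)) => t t01.
  split; first by have := hump01 _ t01; lra.
  by rewrite clamp_idP// fE// /ramp /side /= mulN1r mulr1 mulr0 mul0r addr0.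
have [l monY] : exists l, loop_monodromy tau (st true (0, 1)) =
    ((a l)^-1 * a' (- 1) * a l)%g.
  have [_ _ _ fE] := straightP iK ij ji j_cont K_surface off0 true (0, 1).
  have := monodromy_meridian K_open K_inv mult DP aD a'D ap a'q
    (r := fun t => 1 + hump t) (reg_conv (st true (0, 1))) off0.
  apply.
  - by rewrite clamp0 loop0 ij// tube1.
  - exact: ends.
  - move=> t t01; split; first by rewrite /hump; nra.
    have t01' : 0 <= t <= 1 by lra.
    rewrite clamp_idP// fE//.
    by rewrite /ramp /side /= mul1r mulr1 mulr0 mul0r addr0.
have [d [d_cont d0 d1 _]] := joined_base iK ij ji j_cont K_surface off0 b.
have [c1 [c2 monC]] := loop_monodromy_conj tau_near d_cont d0 d1.
apply: (@torsion_of_commuting_power _ (pi1_conj d_cont d0 d1 X1) (pi1_conj d_cont d0 d1 Y1) N).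
- exact: N0.
- by rewrite /commute -pi1_conjX -!pi1_conjM commN.
move=> /esym; rewrite /commute -!pi1_conjM.
rewrite -[(X1 * Y1)%g]/(pi1_mul _ _) -[(Y1 * X1)%g]/(pi1_mul _ _).
rewrite !pi1_mulE !pi1_conjE => /loop_classP/(loop_monodromy_homotopic tau_near).
rewrite !monC => /mulIg/mulgI; rewrite !(loop_monodromy_cat tau_near) monX monY => E.
apply: aa'; apply: (mulgI (a l)^-1%g); apply: (mulIg (a l)).
have al : (a (-1) * a l = a l * a (-1))%g by rewrite -!aD addrC.
have al' : ((a l)^-1 * a (-1) = a (-1) * (a l)^-1)%g.
  by rewrite -(int_homN aD) -!aD addrC.
have EL : ((a l)^-1 * (a (-1) * a' (-1)) * a l =
           a (-1) * ((a l)^-1 * a' (-1) * a l))%g by rewrite !mulgA al'.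
have ER : ((a l)^-1 * (a' (-1) * a (-1)) * a l =
           ((a l)^-1 * a' (-1) * a l) * a (-1))%g by rewrite -!mulgA al.
by rewrite EL ER.
Qed.

End TorusKnotGroup.

Theorem corollary6 (R : realType) (p q : int) (K : set 'rV[R]_3)
    (hpq : coprimez p q) (hp : 1 < `|p|) (hq : 1 < `|q|)
    (hK : torus_knot p q K) (b : ~` K) :
  exists g : pi1 R b, generalized_torsion g.
Proof.
have [_ [h [[h_cont [k [k_cont hk kh]]] _ [c [x [y [[c_cont c_per c_inj] c_range]]]]]]] := hK.
move=> [x_cont y_cont] cE per.
(* undo h, so as to work around the standard torus *)
pose i (v : ~` K) := k (set_val v).
pose j (v : 'rV[R]_3) : ~` K :=
  match pselect ((~` K) (h v)) with
  | left H => exist _ (h v) (mem_set H)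
  | right _ => b
  end.
pose K' : set 'rV[R]_3 := [set v | K (h v)].
have jE v : ~ K' v -> set_val (j v) = h v.
  by move=> nK; rewrite /j; case: pselect.
apply: (@torus_complement_torsion R p q K' hpq hp hq (fun t => k (c t)) x y _ _ _
  x_cont y_cont _ _ _ _ i j).
- exact: continuous_compfun k_cont.
- by move=> s t /(can_inj kh); exact: c_inj.
- apply/seteqP; split => v.
    by move=> [t _ <-]; rewrite /K' /= kh -c_range; exists t.
  rewrite /K' /= -c_range => -[t _ E]; exists t => //.
  by rewrite E hk.
- by move=> t; rewrite cE hk.
- by move=> t; case: (per t).
- by move=> t; case: (per t).
- exact: (continuous_compfun (@initial_continuous _ _ (@set_val _ (~` K))) k_cont).
- by move=> v; rewrite /K' /= kh; exact: (set_valP v).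
- by move=> v nK; rewrite /i jE// hk.
- by move=> v; apply: val_inj; rewrite [LHS]jE; rewrite /K' /= kh //; exact: (set_valP v).
- move=> U f f_cont fK; apply: continuous_comp_initial.
  have -> : set_val \o (fun u => j (f u)) = h \o f by apply/funext => u /=; rewrite jE.
  exact: continuous_compfun h_cont.
Qed.
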